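(* For any $n\ge4$, $\mathfrak b_n^{\mathbf Q}(4)=[\mathfrak b_n^{\mathbf Q}(3),\mathfrak b_n^{\mathbf Q}(1)]$, and $\mathfrak b_3(4)=[\mathfrak b_3(3),\mathfrak b_3(1)]$. In other words, $H_1(\mathfrak b_n,\mathbf Q)_4=0$ for $n\ge 4$, and $H_1(\mathfrak b_3,\mathbf Z)_4=0$.
   Context: Let $\mathcal L_n=\bigoplus_{k\ge1}\mathcal L_n(k)$ be the free Lie algebra over $\mathbf Z$ on the free abelian group $H$ with basis $x_1,\dots,x_n$, graded by weight, and let $x_1^*,\dots,x_n^*$ be the dual basis of $H^*$. Brackets $[a_1,\dots,a_k]$ are left-normed. An element of $H^*\otimes_{\mathbf Z}\mathcal L_n(k+1)=\mathrm{Hom}_{\mathbf Z}(H,\mathcal L_n(k+1))$ is identified with the derivation of $\mathcal L_n$ of degree $k$ extending it; the bracket of derivations is $[f,g]=g\circ f-f\circ g$. For $k\ge1$, $\mathfrak p_n(k)$ is the $\mathbf Z$-submodule of $H^*\otimes\mathcal L_n(k+1)$ generated by all $x_i^*\otimes[x_{j_1},\dots,x_{j_k},x_i]$ with $1\le i,j_1,\dots,j_k\le n$, and $\mathfrak b_n(k)=\{\sum_i x_i^*\otimes C_i\in\mathfrak p_n(k)\mid\sum_iC_i=0\}$. The graded sum $\mathfrak b_n=\bigoplus_{k\ge1}\mathfrak b_n(k)$ is a Lie subalgebra of the derivation Lie algebra. A superscript $\mathbf Q$ means tensoring with $\mathbf Q$ over $\mathbf Z$. $[\mathfrak b_n(k),\mathfrak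 b_n(l)]$ denotes the submodule spanned by brackets. $H_1(\mathfrak b_n,\mathbf Z)=\mathfrak b_n/[\mathfrak b_n,\mathfrak b_n]$ and $H_1(\mathfrak b_n,\mathbf Q)=\mathfrak b_n^{\mathbf Q}/[\mathfrak b_n^{\mathbf Q},\mathfrak b_n^{\mathbf Q}]$ are graded by degree, and the subscript $k$ denotes the degree $k$ part. *)

(* Defs.v *)
From HB Require Import structures.
From mathcomp Require Import all_boot all_order all_algebra.
From mathcomp Require Import boolp classical_sets.
From mathcomp Require Import generic_quotient ring_quotient.

Set Implicit Arguments.
Unset Strict Implicit.
Unset Printing Implicit Defensive.

Import GRing.Theory.
Local Open Scope ring_scope.
Local Open Scope classical_set_scope.
Local Open Scope quotient_scope.

Definition zspan (M : zmodType) (S : set M) : set M :=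
  smallest (fun A : set M => zmod_closed [in A]) S.

Definition qspan (M : lmodType rat) (S : set M) : set M :=
  smallest (fun A : set M => submod_closed [in A]) S.

(* The same subsets as boolean predicates, so that they can be the predicate
   of a subtype or the divisor of [Quotient.quot]. *)
Definition zspanp (M : zmodType) (S : set M) : {pred M} := [in zspan S].
Definition qspanp (M : lmodType rat) (S : set M) : {pred M} := [in qspan S].

Lemma zspanpP (M : zmodType) (S : set M) x : x \in zspanp S <-> zspan S x.
Proof. by rewrite inE. Qed.

Lemma qspanpP (M : lmodType rat) (S : set M) x : x \in qspanp S <-> qspan S x.
Proof. by rewrite inE. Qed.

Lemma sub_zspan (M : zmodType) (S : set M) : S `<=` zspan S.
Proof. by move=> x Sx A [_]; apply. Qed.

Lemma sub_qspan (M : lmodType rat) (S : set M) : S `<=` qspan S.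
Proof. by move=> x Sx A [_]; apply. Qed.

Fact zspan_closed (M : zmodType) (S : set M) : zmod_closed (zspanp S).
Proof.
split=> [|x y /zspanpP Sx /zspanpP Sy]; apply/zspanpP => A [cA SA].
  by case: cA => /set_mem.
by case: (cA) => _ cB; apply/set_mem/cB; apply/mem_set; [apply: Sx|apply: Sy].
Qed.

Fact qspan_closed (M : lmodType rat) (S : set M) : submod_closed (qspanp S).
Proof.
split=> [|a x y /qspanpP Sx /qspanpP Sy]; apply/qspanpP => A [cA SA].
  by case: cA => /set_mem.
by case: (cA) => _ cB; apply/set_mem/cB; apply/mem_set; [apply: Sx|apply: Sy].
Qed.

HB.instance Definition _ (M : zmodType) (S : set M) :=
  GRing.isZmodClosed.Build M (zspanp S) (zspan_closed S).
HB.instance Definition _ (M : lmodType rat) (S : set M) :=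
  GRing.isSubmodClosed.Build rat M (qspanp S) (qspan_closed S).

Lemma zspan_ind (M : zmodType) (S P : set M) :
    P 0 -> (forall x y, P x -> P y -> P (x - y)) -> S `<=` P -> zspan S `<=` P.
Proof.
move=> P0 PB SP x; apply; split=> //; split; first exact/mem_set.
by move=> u v /set_mem Pu /set_mem Pv; apply/mem_set/PB.
Qed.

Lemma zspan0 (M : zmodType) (S : set M) : zspan S 0.
Proof. by apply/zspanpP/rpred0. Qed.

Lemma zspanB (M : zmodType) (S : set M) x y :
  zspan S x -> zspan S y -> zspan S (x - y).
Proof. by move=> /zspanpP Sx /zspanpP Sy; apply/zspanpP/rpredB. Qed.

Lemma zspanN (M : zmodType) (S : set M) x : zspan S x -> zspan S (- x).
Proof. by move=> /zspanpP Sx; apply/zspanpP; rewrite rpredN. Qed.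

Lemma zspanD (M : zmodType) (S : set M) x y :
  zspan S x -> zspan S y -> zspan S (x + y).
Proof. by move=> /zspanpP Sx /zspanpP Sy; apply/zspanpP/rpredD. Qed.

Record zpres := ZPres {
  zp_term :> Type;
  zp_zero : zp_term;
  zp_opp : zp_term -> zp_term;
  zp_add : zp_term -> zp_term -> zp_term;
  zp_eq : zp_term -> zp_term -> Prop;
  zp_refl : forall s, zp_eq s s;
  zp_sym : forall s t, zp_eq s t -> zp_eq t s;
  zp_trans : forall s t u, zp_eq s t -> zp_eq t u -> zp_eq s u;
  zp_oppP : forall s s', zp_eq s s' -> zp_eq (zp_opp s) (zp_opp s');
  zp_addP : forall s s' t t', zp_eq s s' -> zp_eq t t' ->
    zp_eq (zp_add s t) (zp_add s' t');
  zp_addA : forall s t u,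
    zp_eq (zp_add s (zp_add t u)) (zp_add (zp_add s t) u);
  zp_addC : forall s t, zp_eq (zp_add s t) (zp_add t s);
  zp_add0 : forall s, zp_eq (zp_add zp_zero s) s;
  zp_addN : forall s, zp_eq (zp_add (zp_opp s) s) zp_zero
}.

Section ZQuotient.
Variable P : zpres.

Definition zcarrier : Type := zp_term P.
HB.instance Definition _ := gen_eqMixin zcarrier.
HB.instance Definition _ := gen_choiceMixin zcarrier.

Definition zequiv (s t : zcarrier) : bool := `[< zp_eq s t >].

Fact zequiv_is_equiv : equiv_class_of zequiv.
Proof.
split=> [s|s t|t s u]; first exact/asboolP/zp_refl.
  by apply/asboolP/asboolP; apply: zp_sym.
by move=> /asboolP st /asboolP tu; apply/asboolP; apply: zp_trans st tu.
Qed.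

Canonical zequiv_equiv := EquivRelPack zequiv_is_equiv.
Canonical zequiv_encModRel := defaultEncModRel zequiv.

Definition zquot := {eq_quot zequiv}.
HB.instance Definition _ : EqQuotient zcarrier zequiv zquot :=
  EqQuotient.on zquot.
HB.instance Definition _ := Choice.on zquot.

Definition zpi (s : zp_term P) : zquot := \pi_zquot (s : zcarrier).
Definition zrepr (x : zquot) : zp_term P := repr x.

Lemma zreprK x : zpi (zrepr x) = x. Proof. exact: reprK. Qed.

Lemma zpiP s t : zpi s = zpi t <-> zp_eq s t.
Proof.
by split=> [/eqmodP/asboolP//|st]; apply/eqmodP; apply/asboolP.
Qed.

Lemma zrepr_pi s : zp_eq (zrepr (zpi s)) s.
Proof. by apply/zpiP; rewrite zreprK. Qed.

Definition zq_zero := zpi (@zp_zero P).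
Definition zq_opp := locked (fun x => zpi (zp_opp (zrepr x))).
Definition zq_add := locked (fun x y => zpi (zp_add (zrepr x) (zrepr y))).

Lemma zq_addE s t : zq_add (zpi s) (zpi t) = zpi (zp_add s t).
Proof. by rewrite /zq_add -lock; apply/zpiP/zp_addP; apply: zrepr_pi. Qed.

Lemma zq_oppE s : zq_opp (zpi s) = zpi (zp_opp s).
Proof. by rewrite /zq_opp -lock; apply/zpiP/zp_oppP/zrepr_pi. Qed.

Fact zq_addA : associative zq_add.
Proof.
move=> x y z; rewrite -[x]zreprK -[y]zreprK -[z]zreprK !zq_addE.
exact/zpiP/zp_addA.
Qed.

Fact zq_addC : commutative zq_add.
Proof.
by move=> x y; rewrite -[x]zreprK -[y]zreprK !zq_addE; apply/zpiP/zp_addC.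
Qed.

Fact zq_add0 : left_id zq_zero zq_add.
Proof. by move=> x; rewrite -[x]zreprK zq_addE; apply/zpiP/zp_add0. Qed.

Fact zq_addN : left_inverse zq_zero zq_opp zq_add.
Proof. by move=> x; rewrite -[x]zreprK zq_oppE zq_addE; apply/zpiP/zp_addN. Qed.

HB.instance Definition _ :=
  GRing.isZmodule.Build zquot zq_addA zq_addC zq_add0 zq_addN.

Lemma zpi0 : zpi (@zp_zero P) = 0. Proof. by []. Qed.
Lemma zpiD s t : zpi (zp_add s t) = zpi s + zpi t.
Proof. by rewrite -zq_addE. Qed.
Lemma zpiN s : zpi (zp_opp s) = - zpi s.
Proof. by rewrite -zq_oppE. Qed.

End ZQuotient.

Definition biadditive (M N A : zmodType) (phi : M -> N -> A) :=
  (forall x x' y, phi (x + x') y = phi x y + phi x' y) /\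
  (forall x y y', phi x (y + y') = phi x y + phi x y').

Section Biadditive.
Variables (M N A : zmodType) (phi : M -> N -> A).
Hypothesis phiP : biadditive phi.

Lemma biadd0l y : phi 0 y = 0.
Proof. by apply: (addrI (phi 0 y)); rewrite -phiP.1 !addr0. Qed.
Lemma biadd0r x : phi x 0 = 0.
Proof. by apply: (addrI (phi x 0)); rewrite -phiP.2 !addr0. Qed.
Lemma biaddNl x y : phi (- x) y = - phi x y.
Proof. by apply: (addrI (phi x y)); rewrite -phiP.1 !subrr biadd0l. Qed.
Lemma biaddNr x y : phi x (- y) = - phi x y.
Proof. by apply: (addrI (phi x y)); rewrite -phiP.2 !subrr biadd0r. Qed.
Lemma biaddBl x x' y : phi (x - x') y = phi x y - phi x' y.
Proof. by rewrite phiP.1 biaddNl. Qed.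
Lemma biaddBr x y y' : phi x (y - y') = phi x y - phi x y'.
Proof. by rewrite phiP.2 biaddNr. Qed.
End Biadditive.

Section Tensor.
Variables M N : zmodType.

Inductive tterm : Type :=
  | TPure of M & N
  | TZero
  | TOpp of tterm
  | TAdd of tterm & tterm.

Inductive teq : tterm -> tterm -> Prop :=
  | teq_refl s : teq s s
  | teq_sym s t : teq s t -> teq t s
  | teq_trans s t u : teq s t -> teq t u -> teq s u
  | teq_opp s s' : teq s s' -> teq (TOpp s) (TOpp s')
  | teq_add s s' t t' : teq s s' -> teq t t' -> teq (TAdd s t) (TAdd s' t')
  | teq_addA s t u : teq (TAdd s (TAdd t u)) (TAdd (TAdd s t) u)
  | teq_addC s t : teq (TAdd s t) (TAdd t s)
  | teq_add0 s : teq (TAdd TZero s) s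
  | teq_addN s : teq (TAdd (TOpp s) s) TZero
  | teq_pureDl x x' y : teq (TPure (x + x') y) (TAdd (TPure x y) (TPure x' y))
  | teq_pureDr x y y' : teq (TPure x (y + y')) (TAdd (TPure x y) (TPure x y')).

Definition tens_pres : zpres :=
  ZPres teq_refl teq_sym teq_trans teq_opp teq_add
        teq_addA teq_addC teq_add0 teq_addN.

Definition tens := zquot tens_pres.
HB.instance Definition _ := GRing.Zmodule.on tens.

Local Notation tpi := (@zpi tens_pres).

Lemma tpiN s : tpi (TOpp s) = - (tpi s : tens). Proof. exact: zpiN. Qed.
Lemma tpiD s t : tpi (TAdd s t) = (tpi s : tens) + (tpi t : tens).
Proof. exact: zpiD. Qed.

Definition tpure (x : M) (y : N) : tens := @zpi tens_pres (TPure x y).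

Lemma pure_biadd : biadditive tpure.
Proof.
split=> [x x' y|x y y']; rewrite /tpure.
  by rewrite -tpiD; apply/zpiP/teq_pureDl.
by rewrite -tpiD; apply/zpiP/teq_pureDr.
Qed.

Lemma tens_ind (P : tens -> Prop) :
    P 0 -> (forall t, P t -> P (- t)) ->
    (forall s t, P s -> P t -> P (s + t)) ->
    (forall x y, P (tpure x y)) -> forall t, P t.
Proof.
move=> P0 PN PD Ppure t; rewrite -[t]zreprK.
elim: (zrepr t) => [x y||s Ps|s Ps u Pu] //; first exact: Ppure.
  by rewrite tpiN; apply: PN.
by rewrite tpiD; apply: PD.
Qed.

Section Lift.
Variables (A : zmodType) (phi : M -> N -> A).

Fixpoint teval (s : tterm) : A :=
  match s with
  | TPure x y => phi x y
  | TZero => 0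
  | TOpp s => - teval s
  | TAdd s t => teval s + teval t
  end.

(* The additive map with [tpure x y |-> phi x y]; meaningful when [phi] is
   biadditive. *)
Definition tlift (t : tens) : A := teval (zrepr t).

Hypothesis phiP : biadditive phi.

Lemma teval_eq s t : teq s t -> teval s = teval t.
Proof.
elim=> //=; try by move=> *; congruence.
- by move=> *; rewrite addrA.
- by move=> *; rewrite addrC.
- by move=> *; rewrite add0r.
- by move=> *; rewrite addNr.
- by move=> *; rewrite phiP.1.
by move=> *; rewrite phiP.2.
Qed.

Lemma tlift_pi s : tlift (@zpi tens_pres s) = teval s.
Proof. exact: teval_eq (@zrepr_pi tens_pres s). Qed.

Lemma tlift_pure x y : tlift (tpure x y) = phi x y.
Proof. exact: tlift_pi. Qed.
Lemma tlift0 : tlift 0 = 0.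
Proof. exact: (tlift_pi TZero). Qed.
Lemma tliftN t : tlift (- t) = - tlift t.
Proof. by rewrite -[t]zreprK -tpiN !tlift_pi. Qed.
Lemma tliftD s t : tlift (s + t) = tlift s + tlift t.
Proof.
by rewrite -[s]zreprK -[t]zreprK -tpiD !tlift_pi.
Qed.
Lemma tlift_unique (h : tens -> A) :
  {morph h : s t / s + t} -> (forall x y, h (tpure x y) = phi x y) -> h =1 tlift.
Proof.
move=> hD hp.
have h0 : h 0 = 0 by apply: (addrI (h 0)); rewrite -hD !addr0.
have hN t : h (- t) = - h t.
  by apply: (addrI (h t)); rewrite -hD !subrr.
elim/tens_ind => [|t IH|s t IHs IHt|x y].
- by rewrite h0 tlift0.
- by rewrite hN IH tliftN.
- by rewrite hD IHs IHt tliftD.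
by rewrite hp tlift_pure.
Qed.
End Lift.
End Tensor.

Section Rationalization.
Variable M : zmodType.

Definition rationalize := tens M rat.
HB.instance Definition _ := GRing.Zmodule.on rationalize.

Definition rscale (a : rat) (t : rationalize) : rationalize :=
  tlift (fun x q => tpure x (a * q)) t.

Lemma rscale_biadd a : biadditive (fun (x : M) (q : rat) => tpure x (a * q)).
Proof.
split=> [x x' q|x q q']; first exact: (pure_biadd M rat).1.
by rewrite mulrDr (pure_biadd M rat).2.
Qed.

Lemma rscale_pure a x q : rscale a (tpure x q) = tpure x (a * q).
Proof. exact: tlift_pure (rscale_biadd a) x q. Qed.

Fact rscaleDr : right_distributive rscale +%R.
Proof. by move=> a s t; apply: tliftD (rscale_biadd a) s t. Qed.

Lemma rscale0 a : rscale a 0 = 0.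
Proof. exact: tlift0 (rscale_biadd a). Qed.
Lemma rscaleN a t : rscale a (- t) = - rscale a t.
Proof. exact: tliftN (rscale_biadd a) t. Qed.

Fact rscaleA a b t : rscale a (rscale b t) = rscale (a * b) t.
Proof.
elim/tens_ind: t => [|t IH|s t IHs IHt|x q].
- by rewrite !rscale0.
- by rewrite !rscaleN IH.
- by rewrite !rscaleDr IHs IHt.
by rewrite !rscale_pure mulrA.
Qed.

Fact rscale1 : left_id 1 rscale.
Proof.
elim/tens_ind => [|t IH|s t IHs IHt|x q].
- by rewrite !rscale0.
- by rewrite !rscaleN IH.
- by rewrite !rscaleDr IHs IHt.
by rewrite !rscale_pure mul1r.
Qed.

Fact rscaleDl t : {morph rscale^~ t : a b / a + b}.
Proof.
move=> a b; elim/tens_ind: t => [|t IH|s t IHs IHt|x q].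
- by rewrite !rscale0 addr0.
- by rewrite !rscaleN IH opprD.
- by rewrite !rscaleDr IHs IHt addrACA.
by rewrite !rscale_pure mulrDl (pure_biadd M rat).2.
Qed.

HB.instance Definition _ := GRing.Zmodule_isLmodule.Build rat rationalize
  rscaleA rscale1 rscaleDr rscaleDl.

(* The Q-bilinear extension of a biadditive operation on [M]:
   [br (x (x) p) (y (x) q) = br x y (x) pq]. *)
Definition rbr (br : M -> M -> M) (s t : rationalize) : rationalize :=
  tlift (fun x p => tlift (fun y q => tpure (br x y) (p * q)) t) s.

Section Rbr.
Variable br : M -> M -> M.
Hypothesis brP : biadditive br.

Lemma rbr_biadd1 x p :
  biadditive (fun (y : M) (q : rat) => tpure (br x y) (p * q)).
Proof.
split=> *; rewrite ?brP.2 ?mulrDr.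
  exact: (pure_biadd M rat).1.
exact: (pure_biadd M rat).2.
Qed.

Lemma rbr_biadd2 (t : rationalize) :
  biadditive (fun x p => tlift (fun (y : M) (q : rat) => tpure (br x y) (p * q)) t).
Proof.
split=> [x x' p|x p p'].
  elim/tens_ind: t => [|t IH|s t IHs IHt|y q].
  - by rewrite !(tlift0 (rbr_biadd1 _ _)) addr0.
  - by rewrite !(tliftN (rbr_biadd1 _ _)) IH opprD.
  - by rewrite !(tliftD (rbr_biadd1 _ _)) IHs IHt addrACA.
  by rewrite !(tlift_pure (rbr_biadd1 _ _)) brP.1 (pure_biadd M rat).1.
elim/tens_ind: t => [|t IH|s t IHs IHt|y q].
- by rewrite !(tlift0 (rbr_biadd1 _ _)) addr0.
- by rewrite !(tliftN (rbr_biadd1 _ _)) IH opprD.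
- by rewrite !(tliftD (rbr_biadd1 _ _)) IHs IHt addrACA.
by rewrite !(tlift_pure (rbr_biadd1 _ _)) mulrDl (pure_biadd M rat).2.
Qed.

Lemma rbr_pure x p y q :
  rbr br (tpure x p) (tpure y q) = tpure (br x y) (p * q).
Proof.
by rewrite /rbr (tlift_pure (rbr_biadd2 _)) (tlift_pure (rbr_biadd1 _ _)).
Qed.

Lemma rbr_biadd : biadditive (rbr br).
Proof.
split=> [s s' t|s t t']; first exact: (tliftD (rbr_biadd2 t)).
elim/tens_ind: s => [|s IH|s s' IHs IHs'|x p].
- by rewrite /rbr !(tlift0 (rbr_biadd2 _)) addr0.
- by move: IH; rewrite /rbr !(tliftN (rbr_biadd2 _)) => ->; rewrite opprD.
- move: IHs IHs'; rewrite /rbr !(tliftD (rbr_biadd2 _)) => -> ->.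
  exact: addrACA.
by rewrite /rbr !(tlift_pure (rbr_biadd2 _)) (tliftD (rbr_biadd1 _ _)).
Qed.
End Rbr.
End Rationalization.

Record is_lie (A : zmodType) (br : A -> A -> A) : Prop := IsLie {
  lie_biadd : biadditive br;
  lie_alt : forall x, br x x = 0;
  lie_jacobi : forall x y z,
    br x (br y z) + br y (br z x) + br z (br x y) = 0
}.

Section FreeLie.
Variable n : nat.

Inductive lterm : Type :=
  | LGen of 'I_n
  | LZero
  | LOpp of lterm
  | LAdd of lterm & lterm
  | LBr of lterm & lterm.

Inductive lieq : lterm -> lterm -> Prop :=
  | lieq_refl s : lieq s s
  | lieq_sym s t : lieq s t -> lieq t s
  | lieq_trans s t u : lieq s t -> lieq t u -> lieq s u
  | lieq_opp s s' : lieq s s' -> lieq (LOpp s) (LOpp s')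
  | lieq_add s s' t t' : lieq s s' -> lieq t t' -> lieq (LAdd s t) (LAdd s' t')
  | lieq_br s s' t t' : lieq s s' -> lieq t t' -> lieq (LBr s t) (LBr s' t')
  | lieq_addA s t u : lieq (LAdd s (LAdd t u)) (LAdd (LAdd s t) u)
  | lieq_addC s t : lieq (LAdd s t) (LAdd t s)
  | lieq_add0 s : lieq (LAdd LZero s) s
  | lieq_addN s : lieq (LAdd (LOpp s) s) LZero
  | lieq_brDl s s' t : lieq (LBr (LAdd s s') t) (LAdd (LBr s t) (LBr s' t))
  | lieq_brDr s t t' : lieq (LBr s (LAdd t t')) (LAdd (LBr s t) (LBr s t'))
  | lieq_brxx s : lieq (LBr s s) LZero
  | lieq_jacobi s t u :
      lieq (LAdd (LAdd (LBr s (LBr t u)) (LBr t (LBr u s))) (LBr u (LBr s t)))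
          LZero.

Definition lie_pres : zpres :=
  ZPres lieq_refl lieq_sym lieq_trans lieq_opp lieq_add
        lieq_addA lieq_addC lieq_add0 lieq_addN.

Definition freelie := zquot lie_pres.
HB.instance Definition _ := GRing.Zmodule.on freelie.

Local Notation pi := (@zpi lie_pres).

Lemma lpiN s : pi (LOpp s) = - (pi s : freelie). Proof. exact: zpiN. Qed.
Lemma lpiD s t : pi (LAdd s t) = (pi s : freelie) + (pi t : freelie).
Proof. exact: zpiD. Qed.

Definition gen (i : 'I_n) : freelie := pi (LGen i).
Definition lbr : freelie -> freelie -> freelie :=
  locked (fun a b : freelie => pi (LBr (zrepr a) (zrepr b))).

Lemma lbr_pi s t : lbr (pi s) (pi t) = pi (LBr s t).
Proof. by rewrite /lbr -lock; apply/zpiP/lieq_br; apply: (@zrepr_pi lie_pres). Qed.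

Lemma lbr_lie : is_lie lbr.
Proof.
split; first split.
- move=> x x' y; rewrite -[x]zreprK -[x']zreprK -[y]zreprK.
  by rewrite -lpiD !lbr_pi -lpiD; apply/zpiP/lieq_brDl.
- move=> x y y'; rewrite -[x]zreprK -[y']zreprK -[y]zreprK.
  by rewrite -lpiD !lbr_pi -lpiD; apply/zpiP/lieq_brDr.
- by move=> x; rewrite -[x]zreprK lbr_pi; apply/zpiP/lieq_brxx.
move=> x y z; rewrite -[x]zreprK -[z]zreprK -[y]zreprK !lbr_pi.
by rewrite -!lpiD; apply/zpiP/lieq_jacobi.
Qed.

Lemma freelie_ind (P : freelie -> Prop) :
    P 0 -> (forall a, P a -> P (- a)) ->
    (forall a b, P a -> P b -> P (a + b)) ->
    (forall a b, P a -> P b -> P (lbr a b)) ->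
    (forall i, P (gen i)) -> forall a, P a.
Proof.
move=> P0 PN PD PB Pg a; rewrite -[a]zreprK.
elim: (zrepr a) => [i||s Ps|s Ps t Pt|s Ps t Pt] //.
- exact: Pg.
- by rewrite lpiN; apply: PN.
- by rewrite lpiD; apply: PD.
by rewrite -lbr_pi; apply: PB.
Qed.

Section Univ.
Variables (A : zmodType) (br : A -> A -> A) (f : 'I_n -> A).

Fixpoint leval (s : lterm) : A :=
  match s with
  | LGen i => f i
  | LZero => 0
  | LOpp s => - leval s
  | LAdd s t => leval s + leval t
  | LBr s t => br (leval s) (leval t)
  end.

Definition freelie_lift (a : freelie) : A := leval (zrepr a).

Hypothesis brP : is_lie br.

Lemma leval_eq s t : lieq s t -> leval s = leval t.
Proof.
case: brP => -[brDl brDr] brxx jac.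
elim=> //=; try by move=> *; congruence.
- by move=> *; rewrite addrA.
- by move=> *; rewrite addrC.
- by move=> *; rewrite add0r.
by move=> *; rewrite addNr.
Qed.

Lemma freelie_lift_pi s : freelie_lift (pi s) = leval s.
Proof. exact: leval_eq (@zrepr_pi lie_pres s). Qed.

Lemma freelie_univ : exists! h : freelie -> A,
  [/\ {morph h : a b / a + b}, {morph h : a b / lbr a b >-> br a b}
    & forall i, h (gen i) = f i].
Proof.
exists freelie_lift; split; first split.
- move=> a b; rewrite -[a]zreprK -[b]zreprK -lpiD.
  by rewrite !freelie_lift_pi.
- by move=> a b; rewrite -[a]zreprK -[b]zreprK lbr_pi !freelie_lift_pi.
- by move=> i; rewrite freelie_lift_pi.
move=> h [hD hB hg]; apply/funext => a; rewrite -[a]zreprK freelie_lift_pi.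
have h0 : h 0 = 0 by apply: (addrI (h 0)); rewrite -hD !addr0.
have hN b : h (- b) = - h b by apply: (addrI (h b)); rewrite -hD !subrr.
elim: (zrepr a) => [i||s Ps|s Ps t Pt|s Ps t Pt] /=.
- by rewrite -hg.
- by rewrite -h0.
- by rewrite lpiN hN Ps.
- by rewrite lpiD hD Ps Pt.
by rewrite -lbr_pi hB Ps Pt.
Qed.
End Univ.

(* Left-normed brackets; the value on the empty sequence is a dummy. *)
Definition lnbr (s : seq freelie) : freelie :=
  if s is a :: s' then foldl lbr a s' else 0.

(* [H^* (x) L_n = Hom(H, L_n)]; the element [\sum_i x_i^* (x) C_i] is
   [[ffun i => C_i]]. *)
Definition Der := {ffun 'I_n -> freelie}.

Definition etens (i : 'I_n) (C : freelie) : Der :=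
  [ffun j => if j == i then C else 0].

Fixpoint lder (f : Der) (s : lterm) : freelie :=
  match s with
  | LGen i => f i
  | LZero => 0
  | LOpp s => - lder f s
  | LAdd s t => lder f s + lder f t
  | LBr s t => lbr (lder f s) (pi t) + lbr (pi s) (lder f t)
  end.

(* The derivation of [L_n] extending [f]. *)
Definition der (f : Der) (a : freelie) : freelie := lder f (zrepr a).

Let lD := lie_biadd lbr_lie.

Lemma lbrC a b : lbr a b = - lbr b a.
Proof.
apply/eqP; rewrite -addr_eq0; apply/eqP.
have := lie_alt lbr_lie (a + b).
by rewrite lD.1 !lD.2 !(lie_alt lbr_lie) add0r addr0.
Qed.

Lemma lbr_jacobi a b c : lbr a (lbr b c) = lbr (lbr a b) c - lbr (lbr a c) b.
Proof.
apply/eqP; rewrite -subr_eq0 opprB addrA; apply/eqP.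
rewrite -[RHS](lie_jacobi lbr_lie a b c) [lbr (lbr a b) c]lbrC.
by rewrite [lbr (lbr a c) b]lbrC [lbr a c]lbrC (biaddNr lD) !opprK.
Qed.

Lemma lder_eq f s t : lieq s t -> lder f s = lder f t.
Proof.
suff: lieq s t -> lder f s = lder f t /\ lieq s t by move=> h /h[].
elim=> //=.
- by move=> *; split; last exact: lieq_refl.
- by move=> {}s {}t _ [-> st]; split=> //; apply: lieq_sym.
- by move=> {}s {}t u _ [-> st] _ [-> tu]; split=> //; apply: lieq_trans st tu.
- by move=> {}s s' _ [-> st]; split=> //; apply: lieq_opp.
- by move=> {}s s' {}t t' _ [-> ?] _ [-> ?]; split=> //; apply: lieq_add.
- move=> {}s s' {}t t' _ [-> ss'] _ [-> tt']; split; last exact: lieq_br.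
  have -> : pi s = pi s' by apply/zpiP.
  by have -> : pi t = pi t' by apply/zpiP.
- by move=> *; split; [rewrite addrA|apply: lieq_addA].
- by move=> *; split; [rewrite addrC|apply: lieq_addC].
- by move=> *; split; [rewrite add0r|apply: lieq_add0].
- by move=> *; split; [rewrite addNr|apply: lieq_addN].
- move=> {}s s' {}t; split; last exact: lieq_brDl.
  by rewrite lpiD !lD.1 addrACA.
- move=> {}s {}t t'; split; last exact: lieq_brDr.
  by rewrite lpiD !lD.2 addrACA.
- move=> {}s; split; last exact: lieq_brxx.
  by rewrite lbrC addNr.
move=> {}s {}t u; split; last exact: lieq_jacobi.
rewrite -!lbr_pi !lD.2.
set S := pi s; set T := pi t; set U := pi u.
set s1 := lder f s; set t1 := lder f t; set u1 := lder f u.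
have Js := lie_jacobi lbr_lie s1 T U; have Jt := lie_jacobi lbr_lie S t1 U.
have Ju := lie_jacobi lbr_lie S T u1.
by rewrite (AC ((1*2)*(1*2)*(1*2)) ((1*6*8)*(2*4*9)*(3*5*7))) /= Js Jt Ju !addr0.
Qed.

Lemma der_pi f s : der f (pi s) = lder f s.
Proof. exact: lder_eq (@zrepr_pi lie_pres s). Qed.

Lemma der_gen f i : der f (gen i) = f i. Proof. exact: der_pi. Qed.
Lemma der0 f : der f 0 = 0. Proof. exact: (der_pi f LZero). Qed.
Lemma derN f a : der f (- a) = - der f a.
Proof. by rewrite -[a]zreprK -lpiN !der_pi. Qed.
Lemma derD f a b : der f (a + b) = der f a + der f b.
Proof. by rewrite -[a]zreprK -[b]zreprK -lpiD !der_pi. Qed.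
Lemma derB f a b : der f (a - b) = der f a - der f b.
Proof. by rewrite derD derN. Qed.
Lemma der_lbr f a b : der f (lbr a b) = lbr (der f a) b + lbr a (der f b).
Proof. by rewrite -[a]zreprK -[b]zreprK lbr_pi !der_pi. Qed.

Lemma der_unique (f : Der) (d : freelie -> freelie) :
    {morph d : a b / a + b} ->
    (forall a b, d (lbr a b) = lbr (d a) b + lbr a (d b)) ->
    (forall i, d (gen i) = f i) -> d =1 der f.
Proof.
move=> dD dB dg.
have d0 : d 0 = 0 by apply: (addrI (d 0)); rewrite -dD !addr0.
have dN b : d (- b) = - d b by apply: (addrI (d b)); rewrite -dD !subrr.
elim/freelie_ind => [|a IH|a b IHa IHb|a b IHa IHb|i].
- by rewrite d0 der0.
- by rewrite dN IH derN.
- by rewrite dD IHa IHb derD.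
- by rewrite dB IHa IHb der_lbr.
by rewrite dg der_gen.
Qed.

Lemma der_add (f g : Der) a : der (f + g) a = der f a + der g a.
Proof.
apply: esym; move: a; apply: der_unique => [a b|a b|i].
- by rewrite !derD addrACA.
- by rewrite !der_lbr lD.1 lD.2 addrACA.
by rewrite !der_gen ffunE.
Qed.

(* [[f, g] = g \o f - f \o g] as a map on generators. *)
Definition dbr (f g : Der) : Der := [ffun i => der g (f i) - der f (g i)].

Lemma dbr_biadd : biadditive dbr.
Proof.
split=> [f f' g|f g g']; apply/ffunP => i; rewrite !ffunE derD der_add opprD.
  exact: addrACA.
exact: addrACA.
Qed.

Lemma der_dbr f g a : der (dbr f g) a = der g (der f a) - der f (der g a).
Proof.
apply: esym; move: a; apply: der_unique => [a b|a b|i].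
- by rewrite !derD opprD addrACA.
- rewrite !der_lbr !derD !der_lbr (biaddBl lD) (biaddBr lD) opprD !opprD.
  set A1 := lbr (der g (der f a)) b; set A2 := lbr (der f (der g a)) b.
  set B1 := lbr a (der g (der f b)); set B2 := lbr a (der f (der g b)).
  set C := lbr (der f a) _; set D := lbr (der g a) _.
  rewrite (AC ((2*2)*(2*2)) ((1*5)*(4*8)*((2*7)*(3*6)))) /= !subrr.
  by rewrite !addr0.
by rewrite !der_gen ffunE.
Qed.

Definition p_gens (k : nat) : set Der :=
  [set f | exists (i : 'I_n) (j : k.-tuple 'I_n),
     f = etens i (lnbr (rcons [seq gen l | l <- j] (gen i)))].

Definition p_deg (k : nat) : set Der := zspan (p_gens k).

Definition b_deg (k : nat) : set Der :=
  p_deg k `&` [set f | \sum_i f i = 0].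

(* The direct sum of the [b_n(k)], [k >= 1], inside the derivations: the sum
   is direct because elements of [b_n(k)] raise the weight by [k]. *)
Definition b_gens : set Der := \bigcup_(k in [set k | 0 < k]%N) b_deg k.
Definition b_tot : set Der := zspan b_gens.

Definition lnw (k : nat) : set freelie :=
  zspan [set a | exists j : k.-tuple 'I_n, a = lnbr [seq gen l | l <- j]].

Lemma lnbr_rcons s a : s != [::] -> lnbr (rcons s a) = lbr (lnbr s) a.
Proof. by case: s => // b s _; rewrite /= foldl_rcons. Qed.

Lemma lnw_gen i : lnw 1 (gen i).
Proof. by apply: sub_zspan; exists [tuple i]. Qed.

Lemma lnw_lbr_gen k a i : (0 < k)%N -> lnw k a -> lnw k.+1 (lbr a (gen i)).
Proof.
move=> k0; move: a.
apply: zspan_ind => [|a b Wa Wb|_ [j ->]] /=.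
- by rewrite (biadd0l lD); apply: zspan0.
- by rewrite (biaddBl lD); apply: zspanB.
apply: sub_zspan; exists [tuple of rcons j i]; rewrite /= map_rcons lnbr_rcons //.
by rewrite -size_eq0 size_map size_tuple -lt0n.
Qed.

Lemma lnw_ind k (P : set freelie) : (0 < k)%N ->
    P 0 -> (forall a b, P a -> P b -> P (a - b)) ->
    (forall a i, lnw k a -> P (lbr a (gen i))) -> lnw k.+1 `<=` P.
Proof.
move=> k0 P0 PB Pg; apply: zspan_ind => // _ [j ->] /=.
case/tupleP: j => i0 j; case: k k0 j Pg => // k _ j Pg.
have -> : [seq gen l | l <- [tuple of i0 :: j]]
        = rcons [seq gen l | l <- belast i0 j] (gen (last i0 j)).
  by rewrite -map_rcons -lastI.
rewrite lnbr_rcons; last by rewrite -size_eq0 size_map size_belast size_tuple.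
apply: Pg; apply: sub_zspan; have hs : size (belast i0 j) == k.+1.
  by rewrite size_belast size_tuple.
by exists (Tuple hs).
Qed.

Lemma lnw1_ind (P : set freelie) :
    P 0 -> (forall a b, P a -> P b -> P (a - b)) ->
    (forall i, P (gen i)) -> lnw 1 `<=` P.
Proof.
move=> P0 PB Pg; apply: zspan_ind => // _ [j ->] /=.
by case/tupleP: j => i j; rewrite tuple0; exact: Pg.
Qed.

Lemma lnw_lbr k l a b : (0 < k)%N -> (0 < l)%N ->
  lnw k a -> lnw l b -> lnw (k + l) (lbr a b).
Proof.
move=> k0; elim: l k a b k0 => // l IH k a b k0 _ Wa.
have [->|l0] := posnP l.
  move: b; apply: lnw1_ind => [|b c Wb Wc|i] /=.
  - by rewrite (biadd0r lD); apply: zspan0.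
  - by rewrite (biaddBr lD); apply: zspanB.
  by rewrite addn1; apply: lnw_lbr_gen.
move: b; apply: lnw_ind => // [|b c Wb Wc|b i Wb] /=.
- by rewrite (biadd0r lD); apply: zspan0.
- by rewrite (biaddBr lD); apply: zspanB.
rewrite lbr_jacobi; apply: zspanB.
  by rewrite addnS; apply: lnw_lbr_gen; rewrite ?addn_gt0 ?k0 //; apply: IH.
by rewrite -addSnnS; apply: IH => //; apply: lnw_lbr_gen.
Qed.

Lemma etensB i a b : etens i (a - b) = etens i a - etens i b.
Proof. by apply/ffunP => j; rewrite !ffunE; case: eqP; rewrite ?subr0. Qed.

Lemma p_degP k f : (0 < k)%N -> p_deg k f <->
  exists u : 'I_n -> freelie,
    forall i, lnw k (u i) /\ f i = lbr (u i) (gen i).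
Proof.
move=> k0; split.
  move: f; apply: zspan_ind => [|f g [u Hu] [v Hv]|_ [i [j ->]]].
  - exists (fun=> 0) => i; rewrite ffunE (biadd0l lD).
    by split=> //; apply: zspan0.
  - exists (fun i => u i - v i) => i; have [Wu fu] := Hu i; have [Wv gv] := Hv i.
    by rewrite !ffunE fu gv (biaddBl lD); split=> //; apply: zspanB.
  pose w := lnbr [seq gen l | l <- j].
  exists (fun l => if l == i then w else 0) => l; rewrite ffunE.
  case: eqP => [->|_]; last by rewrite (biadd0l lD); split=> //; apply: zspan0.
  rewrite lnbr_rcons; last by rewrite -size_eq0 size_map size_tuple -lt0n.
  by split=> //; apply: sub_zspan; exists j.
move=> [u Hu].
have -> : f = \sum_i etens i (lbr (u i) (gen i)).
  apply/ffunP => j; rewrite sum_ffunE (bigD1 j) //= ffunE eqxx big1 ?addr0.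
    by have [] := Hu j.
  by move=> i ij; rewrite ffunE eq_sym (negbTE ij).
apply: big_ind => [||i _]; [exact: zspan0|exact: zspanD|].
have [+ _] := Hu i; move: (u i).
apply: zspan_ind => [|a b Wa Wb|_ [j ->]] /=.
- rewrite (biadd0l lD); have -> : etens i 0 = 0; last exact: zspan0.
  by apply/ffunP => j; rewrite !ffunE if_same.
- by rewrite (biaddBl lD) etensB; apply: zspanB.
apply: sub_zspan; exists i, j; rewrite lnbr_rcons //.
by rewrite -size_eq0 size_map size_tuple -lt0n.
Qed.

Lemma lnw_der k l f a : (0 < k)%N -> (0 < l)%N ->
  p_deg k f -> lnw l a -> lnw (k + l) (der f a).
Proof.
move=> k0 + /(p_degP _ k0)[u Hu]; elim: l a => // l IH a _.
have gP i : lnw k.+1 (f i).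
  by have [Wu ->] := Hu i; apply: lnw_lbr_gen.
have [->|l0] := posnP l.
  move: a; apply: lnw1_ind => [|b c Wb Wc|i] /=.
  - by rewrite der0; apply: zspan0.
  - by rewrite derB; apply: zspanB.
  by rewrite der_gen addn1.
move: a; apply: lnw_ind => // [|b c Wb Wc|b i Wb] /=.
- by rewrite der0; apply: zspan0.
- by rewrite derB; apply: zspanB.
rewrite der_lbr der_gen; apply: zspanD.
  by rewrite addnS; apply: lnw_lbr_gen; rewrite ?addn_gt0 ?k0 //; apply: IH.
by rewrite -addSnnS addnC; apply: lnw_lbr.
Qed.

Lemma p_deg_dbr k l f g : (0 < k)%N -> (0 < l)%N ->
  p_deg k f -> p_deg l g -> p_deg (k + l) (dbr f g).
Proof.
move=> k0 l0 pf pg.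
have /(p_degP _ k0)[u Hu] := pf; have /(p_degP _ l0)[v Hv] := pg.
apply/p_degP; first by rewrite addn_gt0 k0.
exists (fun i => der g (u i) - der f (v i) + lbr (u i) (v i)) => i.
have [Wu fu] := Hu i; have [Wv gv] := Hv i; split.
  apply: zspanD; last exact: lnw_lbr.
  apply: zspanB; last exact: lnw_der.
  by rewrite addnC; apply: lnw_der.
rewrite ffunE fu gv !der_lbr !der_gen fu gv lD.1 (biaddBl lD) opprD addrACA.
congr (_ + _); rewrite lbr_jacobi [lbr (lbr (u i) (gen i)) _]lbrC.
by rewrite opprK addrK.
Qed.

Lemma der_sum f (s : 'I_n -> freelie) :
  der f (\sum_i s i) = \sum_i der f (s i).
Proof. exact: (big_morph _ (derD f) (der0 f)). Qed.

Lemma b_deg_dbr k l f g : (0 < k)%N -> (0 < l)%N ->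
  b_deg k f -> b_deg l g -> b_deg (k + l) (dbr f g).
Proof.
move=> k0 l0 [pf f0] [pg g0]; split; first exact: p_deg_dbr.
rewrite /= (eq_bigr (fun i => der g (f i) - der f (g i))).
  by rewrite big_split sumrN -!der_sum /= f0 g0 !der0 subrr.
by move=> i _; rewrite ffunE.
Qed.

Lemma b_deg_tot k f : (0 < k)%N -> b_deg k f -> b_tot f.
Proof. by move=> k0 bf; apply: sub_zspan; exists k. Qed.

Lemma b_tot_dbr f g : b_tot f -> b_tot g -> b_tot (dbr f g).
Proof.
move=> + bg; move: f; apply: zspan_ind => [|f f' Bf Bf'|f [k /= k0 bf]] /=.
- by rewrite (biadd0l dbr_biadd); apply: zspan0.
- by rewrite (biaddBl dbr_biadd); apply: zspanB.
move: g bg; apply: zspan_ind => [|g g' Bg Bg'|g [l /= l0 bg]] /=.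
- by rewrite (biadd0r dbr_biadd); apply: zspan0.
- by rewrite (biaddBr dbr_biadd); apply: zspanB.
by apply: (@b_deg_tot (k + l)); rewrite ?addn_gt0 ?k0 //; apply: b_deg_dbr.
Qed.

End FreeLie.

Record bLie (n : nat) := BLie {
  bval : Der n;
  bvalP : bval \in zspanp (@b_gens n)
}.
HB.instance Definition _ n := [isSub for @bval n].
HB.instance Definition _ n := [Choice of bLie n by <:].
HB.instance Definition _ n := [SubChoice_isSubZmodule of bLie n by <:].

Section BLieRing.
Variable n : nat.

Fact bLie_br_subproof (f g : bLie n) :
  dbr (bval f) (bval g) \in zspanp (@b_gens n).
Proof.
by apply/zspanpP; apply: b_tot_dbr; apply: (iffLR (zspanpP _ _)); apply: bvalP.
Qed.

Definition bbr (f g : bLie n) : bLie n := BLie (bLie_br_subproof f g).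

Lemma bbr_biadd : biadditive bbr.
Proof.
by split=> *; apply/val_inj; [apply: (dbr_biadd n).1|apply: (dbr_biadd n).2].
Qed.

Definition bZ (k : nat) : set (bLie n) := [set f | b_deg k (bval f)].

Definition bLieQ := rationalize (bLie n).
HB.instance Definition _ := GRing.Lmodule.on bLieQ.

Definition bbrQ : bLieQ -> bLieQ -> bLieQ := rbr bbr.

(* The image of [b_n(k) (x) Q] in [b_n (x) Q], injective since [Q] is flat. *)
Definition bQ (k : nat) : set bLieQ :=
  qspan [set t : bLieQ | exists f q, bZ k f /\ t = tpure f q].

(* The submodules spanned by the brackets [[f, g]], [f] in [A], [g] in [B]. *)
Definition brackets (A B : set (bLie n)) : set (bLie n) :=
  zspan [set bbr f g | f in A & g in B].
Definition bracketsQ (A B : set bLieQ) : set bLieQ :=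
  qspan ([set bbrQ f g | f in A & g in B] : set bLieQ).

(* [zspanp S] and [qspanp S] are [brackets] and [bracketsQ] of the whole Lie
   algebra; the degree [k] part of [H_1] is the image of the degree [k] part
   of the Lie algebra. *)
Definition H1Z := Quotient.quot (zspanp [set bbr f g | f in setT & g in setT]).
Definition H1Q := Quotient.quot
  (qspanp ([set bbrQ f g | f in setT & g in setT] : set bLieQ)).
HB.instance Definition _ := GRing.Zmodule.on H1Z.
HB.instance Definition _ := GRing.Zmodule.on H1Q.

Lemma H1Z_pi_eq0 (f : bLie n) : \pi_H1Z f = 0 <-> brackets setT setT f.
Proof.
rewrite /brackets -zspanpP -[in X in _ <-> X](subr0 f) Quotient.idealrBE.
by rewrite -(rwP eqP) pi_zeror.
Qed.

Lemma H1Q_pi_eq0 (t : bLieQ) : \pi_H1Q t = 0 <-> bracketsQ setT setT t.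
Proof.
rewrite /bracketsQ -qspanpP -[in X in _ <-> X](subr0 t) Quotient.idealrBE.
by rewrite -(rwP eqP) pi_zeror.
Qed.

Definition H1Z_deg (k : nat) : set H1Z := [set \pi_H1Z f | f in bZ k].
Definition H1Q_deg (k : nat) : set H1Q := [set \pi_H1Q t | t in bQ k].

End BLieRing.

Arguments bZ : clear implicits.
Arguments bQ : clear implicits.
Arguments H1Z_deg : clear implicits.
Arguments H1Q_deg : clear implicits.

(* Main.v *)
Require Import Defs.
From HB Require Import structures.
From mathcomp Require Import all_boot all_order all_algebra.
From mathcomp Require Import boolp classical_sets zify.

Set Implicit Arguments.
Unset Strict Implicit.
Unset Printing Implicit Defensive.

Import GRing.Theory.
Local Open Scope ring_scope.
Local Open Scope classical_set_scope.

(** An element of b_n(k) is a family of Lie elements u_i of weight k with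
    sum_i [u_i, x_i] = 0, acting by x_i |-> [u_i, x_i].  A planar trivalent
    tree with k + 1 leaves labelled by letters provides one: u_i is the sum,
    over the leaves labelled i, of the Lie monomial read off the tree rooted at
    that leaf.  This is [join a b] for the tree obtained from two rooted trees
    a and b by identifying their roots, and it inherits from the Lie bracket
    antisymmetry at each vertex and the IHX relation at each inner edge.

    Everything known here about trees comes from one identity
    ([special_transfer]): for every derivation d and every family as above,
    sum_i reroot (u_i) (d x_i) = sum_i (x_i |-> [d u_i, x_i]), where
    [reroot u v] collects the rootings at the leaves of u of the tree that joins
    u to v.  It holds because (a, b) |-> reroot a (d b) - reroot b (d a)
    satisfies the cyclic identity imposed by Jacobi, so it factors through
    the bracket.  It has two consequences.

    - An element of b_n acts on a tree, by bracketing, leaf by leaf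
      ([dbr_reroot]).  In particular the bracket with the two-leaf tree j -- k
      replaces each leaf j by the fork (k j) and each leaf k by (j k).

    - For d = N_l, counting the occurrences of the letter l, an element f of
      b_n(4) satisfies N_l f = join (u_l) (x_l), which is a combination of
      trees.  So f is congruent to prod_l (1 - N_l) f modulo trees.  On a
      monomial in which l occurs m_l times (counting the leaf at the root) the
      operator P = prod_l (1 - N_l) is the scalar prod_l (1 - m_l), and for five
      letters, not all equal, this is 0 if some letter occurs exactly once and
      (1 - 3)(1 - 2) = 2 otherwise; monomials in a single letter vanish.
      Hence P^2 = 2 P; as P is the identity modulo trees on b_n(4), f = 2 f
      modulo trees.  Thus b_n(4) is spanned by trees over the integers
      ([b_deg4_span_trees5]).

    It remains to write the five-leaf trees (a b) c (d e) as brackets.  If the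
    letters of one cherry are distinct and do not occur on the other three
    leaves, contract the cherry to one leaf: the four-leaf tree so obtained,
    bracketed with the chord on the two letters, gives back the tree
    ([tree5_free_cherry]).  If not, and if the tree is not zero, the two
    cherries share exactly one letter and the tree is (i j) c (i k).  For
    c among i, j, k there are explicit brackets ([tree5_311], [tree5_221]).
    For a fourth letter c = l, the IHX relation shows that (i j) l (i k) is,
    modulo brackets, unchanged when j and l are exchanged, whereas reflection
    in the axis of the tree exchanges j and k with a sign; in the symmetric
    group on j, k, l this forces twice the tree to be a bracket ([tree5_2111]).
    With three letters this last case does not arise, so the statement is
    integral; with more letters the factor 2 is inverted in the rationals. *)

(** * Rerooting trees *)

Section Trees.
Variable n : nat.
Local Notation L := (freelie n).
Local Notation pi := (@zpi (lie_pres n)).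

Let lD := lie_biadd (lbr_lie n).

Lemma lbr0l (a : L) : lbr 0 a = 0. Proof. exact: (biadd0l lD). Qed.
Lemma lbr0r (a : L) : lbr a 0 = 0. Proof. exact: (biadd0r lD). Qed.
Lemma lbrNl (a b : L) : lbr (- a) b = - lbr a b.
Proof. exact: (biaddNl lD). Qed.
Lemma lbrNr (a b : L) : lbr a (- b) = - lbr a b.
Proof. exact: (biaddNr lD). Qed.
Lemma lbrDl (a b c : L) : lbr (a + b) c = lbr a c + lbr b c.
Proof. exact: lD.1. Qed.
Lemma lbrDr (a b c : L) : lbr a (b + c) = lbr a b + lbr a c.
Proof. exact: lD.2. Qed.
Lemma lbrxx (a : L) : lbr a a = 0. Proof. exact: (lie_alt (lbr_lie n)). Qed.

Lemma lbr_cyc (a b c : L) :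
  lbr (lbr a b) c + lbr (lbr b c) a + lbr (lbr c a) b = 0.
Proof.
rewrite (lbrC (lbr a b)) (lbrC (lbr b c)) (lbrC (lbr c a)) -!opprD.
by rewrite -addrA addrC -[LHS]opprK !opprK (lie_jacobi (lbr_lie n)) oppr0.
Qed.

Definition leaf (i : 'I_n) (v : L) : Der n := etens i (lbr v (gen i)).

Lemma leafD i : {morph leaf i : v w / v + w}.
Proof.
move=> v w; apply/ffunP => j; rewrite !ffunE lbrDl.
by case: eqP; rewrite ?addr0.
Qed.

Lemma leafE i v j : leaf i v j = if j == i then lbr v (gen i) else 0.
Proof. by rewrite ffunE. Qed.

(** For a binary tree s whose root edge carries v, the sum over the leaves of s
    of the derivation sending the letter at that leaf to the tree rooted there.
    Descending into [s, t] towards a leaf of s, what hangs above s is the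
    bracket of t and v. *)
Fixpoint lreroot (s : lterm n) (v : L) : Der n :=
  match s with
  | LGen i => leaf i v
  | LZero => 0
  | LOpp s => - lreroot s v
  | LAdd s t => lreroot s v + lreroot t v
  | LBr s t => lreroot s (lbr (pi t) v) + lreroot t (lbr v (pi s))
  end.

Lemma lrerootD s : {morph lreroot s : v w / v + w}.
Proof.
elim: s => [i||s IH|s IHs t IHt|s IHs t IHt] v w /=.
- exact: leafD.
- by rewrite addr0.
- by rewrite IH opprD.
- by rewrite IHs IHt addrACA.
by rewrite lbrDl lbrDr IHs IHt addrACA.
Qed.

Lemma lreroot0 s : lreroot s 0 = 0.
Proof. by apply: (addrI (lreroot s 0)); rewrite -lrerootD !addr0. Qed.

Lemma lreroot_eq s t : lieq s t -> lreroot s =1 lreroot t.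
Proof.
elim=> //=.
- by move=> {}s {}t _ e v; rewrite e.
- by move=> {}s {}t u _ e _ e' v; rewrite e.
- by move=> {}s s' _ e v; rewrite e.
- by move=> {}s s' {}t t' _ e _ e' v; rewrite e e'.
- move=> {}s s' {}t t' ss' e tt' e' v; rewrite e e'.
  have -> : pi s = pi s' by apply/zpiP.
  by have -> : pi t = pi t' by apply/zpiP.
- by move=> * ? /=; rewrite addrA.
- by move=> * ? /=; rewrite addrC.
- by move=> * ? /=; rewrite add0r.
- by move=> * ? /=; rewrite addNr.
- by move=> * ? /=; rewrite lpiD lbrDr lrerootD addrACA.
- by move=> * ? /=; rewrite lpiD lbrDl lrerootD addrACA.
- by move=> {}s v; rewrite -lrerootD (lbrC v) subrr lreroot0.
move=> {}s {}t u v; rewrite -!lbr_pi.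
set S := pi s; set T := pi t; set U := pi u.
have J b c : lbr (lbr b c) v + lbr (lbr v b) c + lbr b (lbr v c) = 0.
  rewrite -[RHS](lbr_cyc b c v) (lbrC b (lbr v c)) (lbrC v c) lbrNl opprK.
  by rewrite addrAC.
(* Each of S, T, U is rerooted at three terms, which cancel by J. *)
rewrite (AC ((1*2)*(1*2)*(1*2)) ((1*6*8)*(4*9*2)*(7*3*5))) /=.
by rewrite -!lrerootD !J !lreroot0 !addr0.
Qed.

Definition reroot (u v : L) : Der n := lreroot (zrepr u) v.

Lemma reroot_pi s v : reroot (pi s) v = lreroot s v.
Proof. exact: lreroot_eq (@zrepr_pi (lie_pres n) s) v. Qed.

Lemma reroot_gen i v : reroot (gen i) v = leaf i v.
Proof. exact: reroot_pi. Qed.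

Lemma reroot_lbr a b v :
  reroot (lbr a b) v = reroot a (lbr b v) + reroot b (lbr v a).
Proof. by rewrite -[a]zreprK -[b]zreprK lbr_pi !reroot_pi. Qed.

Lemma reroot_biadd : biadditive reroot.
Proof.
split=> [x x' y|x y y']; last by rewrite -[x]zreprK !reroot_pi lrerootD.
by rewrite -[x]zreprK -[x']zreprK -lpiD !reroot_pi.
Qed.

Lemma rerootDl a b v : reroot (a + b) v = reroot a v + reroot b v.
Proof. exact: reroot_biadd.1. Qed.
Lemma rerootDr v a b : reroot v (a + b) = reroot v a + reroot v b.
Proof. exact: reroot_biadd.2. Qed.
Lemma reroot0l v : reroot 0 v = 0. Proof. exact: (biadd0l reroot_biadd). Qed.
Lemma reroot0r v : reroot v 0 = 0. Proof. exact: (biadd0r reroot_biadd). Qed.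
Lemma rerootNl a v : reroot (- a) v = - reroot a v.
Proof. exact: (biaddNl reroot_biadd). Qed.
Lemma rerootNr a v : reroot v (- a) = - reroot v a.
Proof. exact: (biaddNr reroot_biadd). Qed.

(** For u = [a, b] the leaves of a contribute [[b, v], a] and those of b
    contribute [[v, a], b], whose sum is [v, [a, b]] by Jacobi.  This is why
    joining two trees gives an element of b_n: [v, u] + [u, v] = 0. *)
Lemma reroot_sum u v : \sum_i reroot u v i = lbr v u.
Proof.
elim/freelie_ind: u v => [|a IH|a b IHa IHb|a b IHa IHb|i] v.
- by rewrite reroot0l lbr0r big1 // => i _; rewrite ffunE.
- rewrite rerootNl lbrNr -IH -sumrN.
  by apply: eq_bigr => i _; rewrite ffunE.
- rewrite rerootDl lbrDr -IHa -IHb -big_split.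
  by apply: eq_bigr => i _; rewrite ffunE.
- rewrite reroot_lbr (eq_bigr _ (fun i _ => ffunE _ i)) big_split /= IHa IHb.
  by rewrite lbr_jacobi (lbrC b v) lbrNl addrC.
rewrite reroot_gen (bigD1 i) //= leafE eqxx big1 ?addr0 // => j ji.
by rewrite leafE (negbTE ji).
Qed.

Lemma p_deg_leaf k i v : (0 < k)%N -> lnw k v -> p_deg k (leaf i v).
Proof.
move=> k0 Wv; apply/p_degP => //.
exists (fun j => if j == i then v else 0) => j.
rewrite leafE; case: eqP => [->|_]; first by split.
by rewrite lbr0l; split=> //; apply: zspan0.
Qed.

Lemma p_deg_reroot k l u v : lnw k.+1 u -> lnw l.+1 v ->
  p_deg (k + l).+1 (reroot u v).
Proof.
elim: k l u v => [|k IH] l u v.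
  move=> Wu Wv; move: u Wu; apply: lnw1_ind => [|a b Pa Pb|i] /=.
  - by rewrite reroot0l; apply: zspan0.
  - by rewrite rerootDl rerootNl; apply: zspanB.
  by rewrite reroot_gen; apply: p_deg_leaf.
move=> Wu Wv; move: u Wu; apply: lnw_ind => // [|a b Pa Pb|a i Wa] /=.
- by rewrite reroot0l; apply: zspan0.
- by rewrite rerootDl rerootNl; apply: zspanB.
rewrite reroot_lbr; apply: zspanD.
  rewrite addSnnS; apply: IH => //.
  by rewrite -add1n; apply: lnw_lbr => //; apply: lnw_gen.
rewrite reroot_gen; apply: p_deg_leaf => //.
by rewrite addSn addnC -addSn -addnS; apply: lnw_lbr.
Qed.

(** The tree obtained by identifying the root of u with the root of v, rooted
    at each of its leaves in turn. *)
Definition join (u v : L) : Der n := reroot u v + reroot v u.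

Lemma joinC u v : join u v = join v u. Proof. exact: addrC. Qed.

Lemma join_biadd : biadditive join.
Proof.
split=> [x x' y|x y y']; rewrite /join rerootDl rerootDr.
  exact: addrACA.
exact: addrACA.
Qed.

Lemma joinDl a b v : join (a + b) v = join a v + join b v.
Proof. exact: join_biadd.1. Qed.
Lemma join0l v : join 0 v = 0. Proof. exact: (biadd0l join_biadd). Qed.
Lemma join0r v : join v 0 = 0. Proof. exact: (biadd0r join_biadd). Qed.
Lemma joinNl a v : join (- a) v = - join a v.
Proof. exact: (biaddNl join_biadd). Qed.
Lemma joinNr a v : join v (- a) = - join v a.
Proof. exact: (biaddNr join_biadd). Qed.

(** Both sides are the trivalent vertex with branches a, b, c, cut open at
    different edges. *)
Lemma join_lbr a b c : join (lbr a b) c = join a (lbr b c).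
Proof. by rewrite /join !reroot_lbr addrA. Qed.

Lemma b_deg_join k l u v : lnw k.+1 u -> lnw l.+1 v ->
  b_deg (k + l).+1 (join u v).
Proof.
move=> Wu Wv; split.
  by apply: zspanD; last rewrite addnC; apply: p_deg_reroot.
rewrite /= (eq_bigr _ (fun i _ => ffunE _ i)) big_split /= !reroot_sum.
by rewrite lbrC addNr.
Qed.

(** The symmetric tree [join u u] is twice [reroot u u]; over the integers the
    half is needed as well. *)
Lemma b_deg_reroot k u : lnw k.+1 u -> b_deg (k + k).+1 (reroot u u).
Proof.
by move=> Wu; split; [exact: p_deg_reroot|rewrite /= reroot_sum lbrxx].
Qed.

(** * Special derivations act on trees *)

Section Cocycle.
Variable d : Der n.

(** The value on a bracket is not recursive: the map vanishes on letters, and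
    [lcocycle_eq] is the statement that this formula is a two-cocycle which the
    relations of the free Lie algebra respect. *)
Fixpoint lcocycle (s : lterm n) : Der n :=
  match s with
  | LGen _ => 0
  | LZero => 0
  | LOpp s => - lcocycle s
  | LAdd s t => lcocycle s + lcocycle t
  | LBr s t => reroot (pi s) (der d (pi t)) - reroot (pi t) (der d (pi s))
  end.

Lemma lcocycle_eq s t : lieq s t -> lcocycle s = lcocycle t.
Proof.
elim=> //=; try by move=> *; congruence.
- move=> {}s s' {}t t' ss' _ tt' _.
  have -> : pi s = pi s' by apply/zpiP.
  by have -> : pi t = pi t' by apply/zpiP.
- by move=> *; rewrite addrA.
- by move=> *; rewrite addrC.
- by move=> *; rewrite add0r.
- by move=> *; rewrite addNr.
- by move=> *; rewrite !lpiD derD rerootDl rerootDr opprD addrACA.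
- by move=> *; rewrite !lpiD derD rerootDl rerootDr opprD addrACA.
- by move=> {}s; rewrite subrr.
move=> {}s {}t u; rewrite -!lbr_pi.
set S := pi s; set T := pi t; set U := pi u.
rewrite !der_lbr !rerootDr !reroot_lbr !opprD.
set s1 := der d S; set t1 := der d T; set u1 := der d U.
(* Expanding gives six terms reroot _ [d _, _], each with both signs. *)
rewrite (AC (((2*2)*(2*2))*(2*2))
  (((1*8)*(2*11))*((5*12)*(6*3))*((9*4)*(10*7)))) /=.
by rewrite !subrr !addr0.
Qed.

Definition cocycle (a : L) : Der n := lcocycle (zrepr a).

Lemma cocycle_pi s : cocycle (pi s) = lcocycle s.
Proof. exact: lcocycle_eq (@zrepr_pi (lie_pres n) s). Qed.

Lemma cocycle0 : cocycle 0 = 0. Proof. exact: (cocycle_pi (LZero n)). Qed.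

Lemma cocycleD : {morph cocycle : a b / a + b}.
Proof.
by move=> a b; rewrite -[a]zreprK -[b]zreprK -lpiD !cocycle_pi.
Qed.

Lemma cocycle_lbr a b :
  cocycle (lbr a b) = reroot a (der d b) - reroot b (der d a).
Proof. by rewrite -[a]zreprK -[b]zreprK lbr_pi cocycle_pi. Qed.

(** The cocycle is evaluated on sum_i [u_i, x_i] = 0. *)
Lemma special_transfer (u : 'I_n -> L) : \sum_i lbr (u i) (gen i) = 0 ->
  \sum_i reroot (u i) (d i) = \sum_i leaf i (der d (u i)).
Proof.
move=> u0; apply/eqP; rewrite -subr_eq0 -sumrB; apply/eqP.
rewrite -[RHS]cocycle0 -u0 (big_morph _ cocycleD cocycle0).
by apply: eq_bigr => i _; rewrite cocycle_lbr der_gen reroot_gen.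
Qed.
End Cocycle.

Lemma b_degP k f : (0 < k)%N -> b_deg k f ->
  exists u : 'I_n -> L, [/\ forall i, lnw k (u i),
    forall i, f i = lbr (u i) (gen i) & \sum_i lbr (u i) (gen i) = 0].
Proof.
move=> k0 [/(p_degP _ k0)[u Hu] f0]; exists u; split=> [i|i|].
- by have [] := Hu i.
- by have [] := Hu i.
by rewrite -[RHS]f0; apply: eq_bigr => i _; have [_ ->] := Hu i.
Qed.

Lemma sum_leafE (w : 'I_n -> L) j : (\sum_i leaf i (w i)) j = lbr (w j) (gen j).
Proof.
rewrite sum_ffunE (bigD1 j) //= leafE eqxx big1 ?addr0 // => i ij.
by rewrite leafE eq_sym (negbTE ij).
Qed.

(** Induction on u reduces this to a single leaf i.  There the bracket involves
    the derivation [leaf i v] applied to the values [w_j, x_j] of g, and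
    [special_transfer] for d = leaf i v identifies the action on the w_j with
    rerooting, at the leaves of w_i, the tree in which [w_i, x_i] is grafted
    to v. *)
Lemma dbr_reroot k g u v : (0 < k)%N -> b_deg k g ->
  dbr (reroot u v) g = reroot (der g u) v + reroot u (der g v).
Proof.
move=> k0 /(b_degP k0)[w [_ gw w0]].
have dD := dbr_biadd n.
elim/freelie_ind: u v => [|a IH|a b IHa IHb|a b IHa IHb|i] v.
- by rewrite der0 !reroot0l (biadd0l dD) addr0.
- by rewrite derN !rerootNl (biaddNl dD) IH opprD.
- by rewrite derD !rerootDl dD.1 IHa IHb addrACA.
- rewrite der_lbr rerootDl !reroot_lbr dD.1 IHa IHb !der_lbr !rerootDr.
  by rewrite (AC ((1*2)*(1*2)) ((1*6)*(2*4)*(3*5))) /=.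
rewrite !reroot_gen der_gen gw reroot_lbr reroot_gen.
have Hleaf : reroot (w i) (lbr (gen i) v)
    = - \sum_j leaf j (der (leaf i v) (w j)).
  rewrite -(special_transfer _ w0) (bigD1 i) //= leafE eqxx big1 ?addr0.
    by rewrite lbrC rerootNr.
  by move=> j ji; rewrite leafE (negbTE ji) reroot0r.
rewrite Hleaf; apply/ffunP => j; rewrite [LHS]ffunE !ffunE sum_leafE.
rewrite gw der_lbr der_gen leafE.
case: eqP => [->|_]; last by rewrite lbr0r !addr0 der0 sub0r.
rewrite der_lbr der_gen gw lbr_jacobi (lbrC (w i) (lbr v _)) opprD opprK.
by rewrite (AC ((1*2)*2) ((4*2*1)*(3*5))) /= addNr addr0.
Qed.

Lemma dbr_join k g u v : (0 < k)%N -> b_deg k g ->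
  dbr (join u v) g = join (der g u) v + join u (der g v).
Proof.
move=> k0 bg; rewrite /join (dbr_biadd n).1 !(dbr_reroot _ _ k0 bg).
by rewrite (AC (2*2) ((1*4)*(2*3))).
Qed.

(** * Trees with five leaves span *)

Definition count_letter (l : 'I_n) : Der n := etens l (gen l).

(** The values of f are [u_i, x_i], so this counts the letter x_i at the root
    besides the letters of u_i. *)
Definition weight_op (l : 'I_n) (f : Der n) : Der n :=
  [ffun i => der (count_letter l) (f i)].

(** When f comes from a tree, both sides are f times the number of leaves
    labelled l: u_l collects the rootings at these leaves, and joining x_l to
    each of them gives back the whole tree. *)
Lemma weight_op_join (f : Der n) l (u : 'I_n -> L) :
    (forall i, f i = lbr (u i) (gen i)) -> \sum_i lbr (u i) (gen i) = 0 ->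
  weight_op l f = join (u l) (gen l).
Proof.
move=> fu u0; rewrite /join reroot_gen.
have := special_transfer (count_letter l) u0.
rewrite (bigD1 l) //= ffunE eqxx big1 ?addr0 => [->|i il]; last first.
  by rewrite ffunE (negbTE il) reroot0r.
apply/ffunP => j; rewrite !ffunE sum_leafE fu der_lbr der_gen ffunE.
by case: eqP => [->|_]; rewrite ?lbr0r.
Qed.

Fact weight_op_is_additive l : zmod_morphism (weight_op l).
Proof. by move=> f g; apply/ffunP => i; rewrite !ffunE derB. Qed.
HB.instance Definition _ l :=
  GRing.isZmodMorphism.Build (Der n) (Der n) (weight_op l)
    (weight_op_is_additive l).

(** The tree with cherries (a b) and (d e) and middle leaf c. *)
Definition tree5 (a b c d e : 'I_n) : Der n :=
  join (lbr (lbr (gen a) (gen b)) (gen c)) (lbr (gen d) (gen e)).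

Definition trees5 : set (Der n) :=
  [set f | exists a b c d e, f = tree5 a b c d e].

Lemma lnw2 a b : lnw 2 (lbr (gen a) (gen b) : L).
Proof. by apply: lnw_lbr_gen => //; apply: lnw_gen. Qed.

Lemma lnw3 a b c : lnw 3 (lbr (lbr (gen a) (gen b)) (gen c) : L).
Proof. by apply: lnw_lbr_gen => //; apply: lnw2. Qed.

Lemma tree5_b a b c d e : b_deg 4 (tree5 a b c d e).
Proof. exact: b_deg_join (lnw3 a b c) (lnw2 d e). Qed.

Lemma b_deg0 k : b_deg k (0 : Der n).
Proof.
by split; [exact: zspan0|rewrite /= big1 // => i _; rewrite ffunE].
Qed.

Lemma b_degB k (f g : Der n) : b_deg k f -> b_deg k g -> b_deg k (f - g).
Proof.
move=> [pf f0] [pg g0]; split; first exact: zspanB.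
rewrite /= (eq_bigr (fun i => f i - g i)) => [|i _]; last by rewrite !ffunE.
by rewrite sumrB f0 g0 subrr.
Qed.

Lemma span_trees5_b f : zspan trees5 f -> b_deg 4 f.
Proof.
move: f; apply: zspan_ind => [|f g|_ [a [b [c [d [e ->]]]]]].
- exact: b_deg0.
- exact: b_degB.
exact: tree5_b.
Qed.

Lemma join_lnw4 u i : lnw 4 u -> zspan trees5 (join u (gen i)).
Proof.
move: u; apply: zspan_ind => [|u v Su Sv|_ [j ->]] /=.
- by rewrite join0l; apply: zspan0.
- by rewrite joinDl joinNl; apply: zspanB.
case/tupleP: j => a j; case/tupleP: j => b j; case/tupleP: j => c j.
case/tupleP: j => d j; rewrite tuple0 /= join_lbr.
by apply: sub_zspan; exists a, b, c, d, i.
Qed.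

Lemma weight_op_span_trees5 l f : b_deg 4 f -> zspan trees5 (weight_op l f).
Proof.
move=> /(@b_degP 4 _ isT)[u [Wu fu u0]].
by rewrite (weight_op_join _ fu u0) //; apply: join_lnw4.
Qed.

(** The composite of the operators 1 - N_l, with N_l = [weight_op l]: on
    b_n(4) it is the identity modulo trees, and it kills the monomials in which some letter of r
    occurs exactly once. *)
Definition weight_sieve (r : seq 'I_n) (f : Der n) : Der n :=
  foldr (fun l g => g - weight_op l g) f r.

Fact weight_sieve_is_additive r : zmod_morphism (weight_sieve r).
Proof.
by elim: r => [|l r IH] f g //; rewrite /= IH raddfB !opprD /= addrACA.
Qed.
HB.instance Definition _ r :=
  GRing.isZmodMorphism.Build (Der n) (Der n) (weight_sieve r)
    (weight_sieve_is_additive r).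

Lemma weight_sieve_mod r f : b_deg 4 f -> zspan trees5 (f - weight_sieve r f).
Proof.
move=> bf; elim: r => [|l r IH] /=; first by rewrite subrr; apply: zspan0.
rewrite opprB addrCA addrC; apply: zspanD => //; apply: weight_op_span_trees5.
by rewrite -[X in b_deg _ X](subKr f); apply: b_degB => //;
  apply: span_trees5_b.
Qed.

Lemma weight_sieve_eigen r f (m : 'I_n -> nat) :
    (forall l, weight_op l f = f *+ m l) ->
  weight_sieve r f = f *~ \prod_(l <- r) (1 - (m l)%:Z).
Proof.
move=> fm; elim: r => [|l r IH] /=; first by rewrite big_nil.
rewrite IH raddfMz /= fm -[f *+ m l]/(f *~ (m l)%:Z) -mulrzA -mulrzBr.
by rewrite big_cons mulrBl mul1r.
Qed.

Lemma der_count_lnbr l (s : seq 'I_n) :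
  der (count_letter l) (lnbr [seq gen i | i <- s])
  = lnbr [seq gen i | i <- s] *+ count_mem l s.
Proof.
have der1 i : der (count_letter l) (gen i) = gen i *+ (i == l).
  by rewrite der_gen ffunE; case: eqP => [->|].
case: s => [|a s] /=; first by rewrite der0.
move: (gen a) (nat_of_bool (a == l)) (der1 a) => x m.
elim: s x m => [|b s IH] x m xm /=; first by rewrite addn0.
rewrite addnA; apply: IH.
have lbrMnl k : lbr (x *+ k) (gen b) = lbr x (gen b) *+ k.
  by elim: k => [|k IHk]; rewrite ?lbr0l // !mulrS lbrDl IHk.
have lbrMnr k : lbr x (gen b *+ k) = lbr x (gen b) *+ k.
  by elim: k => [|k IHk]; rewrite ?lbr0r // !mulrS lbrDr IHk.
by rewrite der_lbr xm der1 lbrMnl lbrMnr mulrnDr.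
Qed.

Lemma weight_op_etens l i C m : der (count_letter l) C = C *+ m ->
  weight_op l (etens i C) = etens i C *+ m.
Proof.
move=> CM; have etensMn k : etens i (C *+ k) = etens i C *+ k.
  elim: k => [|k IHk].
    by apply/ffunP => j; rewrite !ffunE if_same.
  rewrite !mulrS -IHk; apply/ffunP => j; rewrite !ffunE.
  by case: eqP; rewrite ?addr0.
rewrite -etensMn; apply/ffunP => j; rewrite !ffunE.
by case: eqP => _; rewrite ?CM ?der0.
Qed.

(** Among five letters with a <> b, either some letter occurs exactly once and
    the product vanishes, or only a and b occur, three times and twice in some
    order, and the product is 2.  The other case to rule out, five equal
    letters, would give -4. *)
Lemma prod_one_sub_count (a b c d e : 'I_n) : a != b ->
  let p := \prod_l (1 - (count_mem l [:: a; b; c; d; e])%:Z) in p * p = p * 2.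
Proof.
move=> ab p; pose m l := count_mem l [:: a; b; c; d; e].
have p0 l : m l = 1%N -> p * p = p * 2.
  move=> ml; suff -> : p = 0 by rewrite !mul0r.
  by apply/eqP/prodf_eq0; exists l; rewrite // -/(m l) ml.
have [/p0//|ma] := eqVneq (m a) 1%N.
have [/p0//|mb] := eqVneq (m b) 1%N.
have ba := negbTE ab; have ba' : (b == a) = false by rewrite eq_sym.
(* Three distinct letters cannot all occur twice among five. *)
have out x : x \in [:: c; d; e] -> x != a -> x != b -> m x = 1%N.
  move=> xs xa xb.
  have H y : ((y == a) + (y == b) + (y == x) <= 1)%N.
    have [->|_] := eqVneq y a; first by rewrite ba eq_sym (negbTE xa).
    have [->|_] := eqVneq y b; rewrite ?(eq_sym b x) ?(negbTE xb) //.
    by case: (_ == _).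
  have mx : (0 < m x)%N.
    rewrite -has_count; apply/hasP; exists x => //=.
    by move: xs; rewrite !inE => /or3P[]->; rewrite !orbT.
  move: ma mb mx (H c) (H d) (H e); rewrite /m /= !eqxx ba ba'.
  rewrite [a == x]eq_sym [b == x]eq_sym (negbTE xa) (negbTE xb) !add0n.
  lia.
have supp x : x \in [:: c; d; e] -> p * p = p * 2 \/ (x = a \/ x = b).
  move=> xs; have [|xa] := eqVneq x a; first by right; left.
  have [|xb] := eqVneq x b; first by right; right.
  by left; apply: (p0 x); apply: out.
have [//|cab] : p * p = p * 2 \/ (c = a \/ c = b).
  by apply: supp; rewrite !inE eqxx.
have [//|dab] : p * p = p * 2 \/ (d = a \/ d = b).
  by apply: supp; rewrite !inE eqxx ?orbT.
have [//|eab] : p * p = p * 2 \/ (e = a \/ e = b).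
  by apply: supp; rewrite !inE eqxx ?orbT.
have pE : p = (1 - (m a)%:Z) * (1 - (m b)%:Z).
  rewrite /p (bigD1 a) // (bigD1 b) ?ba' //= big1 ?mulr1 // => l /andP[la lb].
  have off x : x = a \/ x = b -> (x == l) = false.
    by case=> ->; rewrite eq_sym; apply: negbTE.
  by rewrite !(off c, off d, off e) // !off; auto.
rewrite pE; move: ma mb; rewrite /m.
by case: cab => ->; case: dab => ->; case: eab => ->; rewrite /= !eqxx ?ba ?ba'.
Qed.

Lemma weight_sieve_sq f : p_deg 4 f ->
  let P := weight_sieve (index_enum 'I_n) in P (P f) = P f *+ 2.
Proof.
move: f; apply: zspan_ind => [|f g /= Pf Pg|_ [i [j ->]]] /=.
- by rewrite !raddf0 mul0rn.
- by rewrite !raddfB /= Pf Pg mulrnBl.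
case/tupleP: j => a j; case/tupleP: j => b j; case/tupleP: j => c j.
case/tupleP: j => d j; rewrite tuple0 /=.
have [->|ab] := eqVneq a b.
  set B := lbr _ (gen i); have -> : etens i B = 0.
    by rewrite /B lbrxx !lbr0l; apply/ffunP => l; rewrite !ffunE if_same.
  by rewrite !raddf0 mul0rn.
set v := etens i _.
have eig l : weight_op l v = v *+ count_mem l [:: a; b; c; d; i].
  by apply: weight_op_etens; apply: (der_count_lnbr l [:: a; b; c; d; i]).
have E := weight_sieve_eigen (index_enum 'I_n) eig.
rewrite !E raddfMz /= E.
by rewrite -mulrzA (prod_one_sub_count c d i ab) mulrzA.
Qed.

(** Modulo trees, P f = f and P (P f) = 2 P f, so f is its own double. *)
Lemma b_deg4_span_trees5 f : b_deg 4 f -> zspan trees5 f.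
Proof.
move=> bf; set P := weight_sieve (index_enum 'I_n).
have bPf : b_deg 4 (P f).
  rewrite -[P f](subKr f); apply: b_degB => //.
  by apply: span_trees5_b; apply: weight_sieve_mod.
have := weight_sieve_mod (index_enum 'I_n) bPf; case: (bf) => pf _.
have sq : P (P f) = P f *+ 2 by exact: weight_sieve_sq.
rewrite -/P sq mulr2n opprD addrA subrr sub0r => SPf.
rewrite -[f](subrK (P f)); apply: zspanD; first exact: weight_sieve_mod.
by rewrite -[P f]opprK; apply: zspanN.
Qed.

(** * Five-leaf trees as brackets *)

Definition chord (i j : 'I_n) : Der n := join (gen i) (gen j).

Lemma chord_b i j : b_deg 1 (chord i j).
Proof. exact: b_deg_join (lnw_gen i) (lnw_gen j). Qed.

Lemma chordE i j k : chord i j k =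
  (if k == i then lbr (gen j) (gen i) else 0)
  + (if k == j then lbr (gen i) (gen j) else 0).
Proof. by rewrite /chord /join !reroot_gen ffunE !leafE. Qed.

Lemma chordl i j : i != j -> der (chord i j) (gen i) = lbr (gen j) (gen i).
Proof. by move=> ij; rewrite der_gen chordE eqxx (negbTE ij) addr0. Qed.

Lemma chordr i j : i != j -> der (chord i j) (gen j) = lbr (gen i) (gen j).
Proof.
by move=> ij; rewrite der_gen chordE eqxx eq_sym (negbTE ij) add0r.
Qed.

Lemma chord_out i j k : k != i -> k != j -> der (chord i j) (gen k) = 0.
Proof.
by move=> ki kj; rewrite der_gen chordE (negbTE ki) (negbTE kj) addr0.
Qed.

Definition brackets31 : set (Der n) :=
  zspan [set dbr f g | f in b_deg 3 & g in b_deg 1].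

Lemma brackets31_dbr f i j : b_deg 3 f -> brackets31 (dbr f (chord i j)).
Proof.
by move=> bf; apply: sub_zspan; exists f => //; exists (chord i j) => //;
  exact: chord_b.
Qed.

Lemma tree5_swapl a b c d e : tree5 a b c d e = - tree5 b a c d e.
Proof. by rewrite /tree5 (lbrC (gen a)) lbrNl joinNl. Qed.

Lemma tree5_swapr a b c d e : tree5 a b c d e = - tree5 a b c e d.
Proof. by rewrite /tree5 (lbrC (gen d)) joinNr. Qed.

Lemma tree5_flip a b c d e : tree5 a b c d e = - tree5 d e c a b.
Proof.
by rewrite /tree5 join_lbr (lbrC (gen c)) joinNr joinC.
Qed.

Lemma tree5_ihx a b c d e :
  tree5 a b c d e = tree5 a c b d e - tree5 b c a d e.
Proof.
have J := lbr_jacobi (gen a) (gen b) (gen c).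
rewrite /tree5 -joinNl -joinDl -(lbrC (gen a)) J.
by rewrite addrC subrK.
Qed.

Lemma tree5_same_cherry a b c : tree5 a b c a b = 0.
Proof. by rewrite /tree5 joinC -join_lbr lbrxx join0l. Qed.

(** With the cherry (j k) contracted to a leaf j, the letter k no longer occurs,
    and j occurs once: the chord j -- k acts on this leaf alone, opening it up
    again. *)
Lemma tree5_free_cherry j k x y z : j != k ->
    j \notin [:: x; y; z] -> k \notin [:: x; y; z] ->
  brackets31 (tree5 j k x y z).
Proof.
move=> jk; rewrite !inE !negb_or => /and3P[jx jy jz] /and3P[kx ky kz].
have bS : b_deg 3 (join (lbr (gen j) (gen x)) (lbr (gen y) (gen z))).
  exact: b_deg_join (lnw2 j x) (lnw2 y z).
have := brackets31_dbr j k bS.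
rewrite (dbr_join (k := 1) _ _ isT (chord_b j k)) !der_lbr chordl //.
rewrite !chord_out // 1?eq_sym // !lbr0r !lbr0l !addr0 join0r addr0.
by rewrite -/(tree5 k j x y z) tree5_swapl => /zspanN; rewrite opprK.
Qed.

(** The four-leaf tree (i j)(i j) has a symmetry exchanging its two leaves i,
    and the chord i -- k acts on both.  On half of that tree it yields the
    five-leaf tree with coefficient 1. *)
Lemma tree5_221 i j k : i != j -> i != k -> j != k ->
  brackets31 (tree5 i j j i k).
Proof.
move=> ij ik jk; rewrite tree5_flip tree5_swapl opprK.
have := brackets31_dbr i k (b_deg_reroot (lnw2 i j)).
rewrite (dbr_reroot (k := 1) _ _ isT (chord_b i k)) der_lbr chordl //.
by rewrite !chord_out // 1?eq_sym // lbr0r addr0.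
Qed.

(** The chord i -- j acts on three leaves of (i j)(i k).  The leaf i next to k
    yields zero, the leaf j yields the tree wanted, and the remaining leaf a
    tree of the kind of [tree5_221]. *)
Lemma tree5_311 i j k : i != j -> i != k -> j != k ->
  brackets31 (tree5 i j i i k).
Proof.
move=> ij ik jk.
have bS : b_deg 3 (join (lbr (gen i) (gen j)) (lbr (gen i) (gen k))).
  exact: b_deg_join (lnw2 i j) (lnw2 i k).
have := brackets31_dbr i j bS.
rewrite (dbr_join (k := 1) _ _ isT (chord_b i j)) !der_lbr chordl // chordr //.
rewrite !(@chord_out i j k) // 1?eq_sym // lbr0r addr0 joinDl.
(* The leaf i next to k opens into (i j), as in the other cherry. *)
have -> : join (lbr (gen i) (gen j)) (lbr (lbr (gen j) (gen i)) (gen k)) = 0.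
  by rewrite (lbrC (gen j)) lbrNl joinNr -join_lbr lbrxx join0l oppr0.
rewrite addr0 (lbrC (gen i) (lbr _ _)) joinNl.
rewrite -/(tree5 j i j i k) -/(tree5 i j i i k).
rewrite tree5_swapl -opprD => /zspanN; rewrite opprK.
move=> /zspanB/(_ (tree5_221 ij ik jk)).
by rewrite addrAC subrr add0r.
Qed.

(** The third term of the IHX relation has the cherry (j l), to which
    [tree5_free_cherry] applies. *)
Lemma brackets31_swap_middle i j k l :
  j != i -> j != k -> l != i -> l != k -> j != l ->
  brackets31 (tree5 i j l i k - tree5 i l j i k).
Proof.
move=> ji jk li lk jl; rewrite (tree5_ihx i j) addrAC subrr add0r.
apply: zspanN.
by apply: tree5_free_cherry; rewrite // !inE !negb_or ?ji ?li ?jk ?lk.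
Qed.

(** Modulo brackets the tree is unchanged when its middle letter is exchanged
    with a neighbour, and changes sign when j and k are exchanged.  The
    transpositions of j, k, l being conjugate, the tree equals its opposite; the
    proof goes around the six orderings of j, k, l. *)
Lemma tree5_2111 i j k l : uniq [:: i; j; k; l] ->
  brackets31 (tree5 i j l i k *+ 2).
Proof.
rewrite /= !inE !negb_or => /andP[/and3P[ij ik il] /and3P[/andP[jk jl] kl _]].
have S1 : brackets31 (tree5 i j l i k - tree5 i l j i k).
  by apply: brackets31_swap_middle => //; rewrite eq_sym.
have S2 : brackets31 (tree5 i k j i l - tree5 i j k i l).
  by apply: brackets31_swap_middle => //; rewrite eq_sym.
have S3 : brackets31 (tree5 i l k i j - tree5 i k l i j).
  by apply: brackets31_swap_middle => //; rewrite eq_sym.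
move: (zspanD (zspanB S1 S2) S3).
rewrite (tree5_flip i k j) (tree5_flip i j k) (tree5_flip i k l).
have E (V : zmodType) (x y z : V) :
    x - y - (- y - - z) + (z - - x) = x *+ 2.
  rewrite !opprD !opprK (AC ((2*2)*2) ((1*6)*((2*3)*(4*5)))) /= !addNr.
  by rewrite !addr0 mulr2n.
by rewrite E.
Qed.

(** A factor 2 is admitted where four distinct letters are available: only for
    trees as in [tree5_2111] is it incurred. *)
Definition almost_bracket (f : Der n) : Prop :=
  brackets31 f \/ (4 <= n)%N /\ brackets31 (f *+ 2).

Lemma almost_bracketN f : almost_bracket f -> almost_bracket (- f).
Proof.
by case=> [|[n4]] /zspanN; [left | rewrite -mulNrn; right].
Qed.

Lemma tree5_shared i j c k : i != j -> i != k ->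
  almost_bracket (tree5 i j c i k).
Proof.
move=> ij ik; have [<-|jk] := eqVneq j k.
  by rewrite tree5_same_cherry; left; apply: zspan0.
have [->|ci] := eqVneq c i; first by left; apply: tree5_311.
have [->|cj] := eqVneq c j; first by left; apply: tree5_221.
have [->|ck] := eqVneq c k.
  left; rewrite tree5_flip; apply: zspanN.
  by apply: tree5_221; rewrite // eq_sym.
have U : uniq [:: i; j; k; c].
  by rewrite /= !inE !negb_or ij ik jk !(eq_sym _ c) ci cj ck.
right; split; last exact: tree5_2111.
by have := max_card (mem [:: i; j; k; c]); rewrite (card_uniqP U) card_ord.
Qed.

(** If the cherries have no letter in common, the middle letter belongs to at
    most one of them, and the other is free in the sense of
    [tree5_free_cherry]. *)
Lemma tree5_almost_bracket a b c d e : almost_bracket (tree5 a b c d e).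
Proof.
have [->|ab] := eqVneq a b.
  by left; rewrite /tree5 lbrxx lbr0l join0l; apply: zspan0.
have [->|de] := eqVneq d e.
  by left; rewrite /tree5 lbrxx join0r; apply: zspan0.
have ba : b != a by rewrite eq_sym.
have ed : e != d by rewrite eq_sym.
have [da|nda] := eqVneq d a.
  by rewrite da in de *; apply: tree5_shared.
have [ea|nea] := eqVneq e a.
  by rewrite ea in ed *; rewrite tree5_swapr; apply/almost_bracketN/tree5_shared.
have [db|ndb] := eqVneq d b.
  by rewrite db in de *; rewrite tree5_swapl; apply/almost_bracketN/tree5_shared.
have [eb|neb] := eqVneq e b.
  rewrite eb in ed *; rewrite tree5_swapl tree5_swapr.
  by do 2!apply: almost_bracketN; apply: tree5_shared.
left; have [cab|] := boolP (c \in [:: a; b]); last first.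
  rewrite !inE negb_or => /andP[ca cb]; apply: tree5_free_cherry => //.
    by rewrite !inE !negb_or !(eq_sym a) ca nda nea.
  by rewrite !inE !negb_or !(eq_sym b) cb ndb neb.
rewrite tree5_flip; apply: zspanN; apply: tree5_free_cherry => //.
  rewrite !inE !negb_or nda ndb !andbT; apply: contraTneq cab => <-.
  by rewrite !inE negb_or nda ndb.
rewrite !inE !negb_or nea neb !andbT; apply: contraTneq cab => <-.
by rewrite !inE negb_or nea neb.
Qed.

Lemma b_deg4_double f : b_deg 4 f -> brackets31 (f *+ 2).
Proof.
move/b_deg4_span_trees5; move: f; apply: zspan_ind => [|f g Wf Wg|f] /=.
- by rewrite mul0rn; apply: zspan0.
- by rewrite mulrnBl; apply: zspanB.
move=> [a [b [c [d [e ->]]]]]; have [W|[_ //]] := tree5_almost_bracket a b c d e.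
by rewrite mulr2n; apply: zspanD.
Qed.

Lemma b_deg4_brackets31 f : (n < 4)%N -> b_deg 4 f -> brackets31 f.
Proof.
move=> n3 /b_deg4_span_trees5; move: f; apply: zspan_ind => [|f g|f] /=.
- exact: zspan0.
- exact: zspanB.
move=> [a [b [c [d [e ->]]]]]; have [//|[n4 _]] := tree5_almost_bracket a b c d e.
by rewrite ltnNge n4 in n3.
Qed.

End Trees.

(** * Brackets in b_n, over the integers and the rationals *)

Section Transfer.
Variable n : nat.

Lemma bval0 : bval (0 : bLie n) = 0.
Proof. exact: (raddf0 (val : bLie n -> Der n)). Qed.
Lemma bvalB (f g : bLie n) : bval (f - g) = bval f - bval g.
Proof. exact: (raddfB (val : bLie n -> Der n)). Qed.

Lemma brackets31_lift h : brackets31 h ->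
  exists2 f : bLie n, brackets (bZ n 3) (bZ n 1) f & bval f = h.
Proof.
move: h; apply: zspan_ind => [|_ _ [f Bf <-] [g Bg <-]|_ [f bf [g bg <-]]] /=.
- by exists 0; [exact: zspan0 | exact: bval0].
- by exists (f - g); [exact: zspanB | exact: bvalB].
have tot k (x : Der n) : (0 < k)%N -> b_deg k x -> x \in zspanp (@b_gens n).
  by move=> k0 bx; apply/zspanpP; apply: b_deg_tot bx.
pose F := BLie (tot 3 f isT bf); pose G := BLie (tot 1%N g isT bg).
by exists (bbr F G) => //; apply: sub_zspan; exists F => //; exists G.
Qed.

Lemma brackets31P f : brackets31 (bval f) -> brackets (bZ n 3) (bZ n 1) f.
Proof. by case/brackets31_lift => g Bg /val_inj <-. Qed.

Lemma brackets_bZ4 f : brackets (bZ n 3) (bZ n 1) f -> bZ n 4 f.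
Proof.
move: f; apply: zspan_ind => [|f g|_ [f bf [g bg <-]]]; rewrite /bZ /=.
- by rewrite -[X in b_deg 4 X]/(bval (0 : bLie n)) bval0; apply: b_deg0.
- move=> bf bg; rewrite -[X in b_deg 4 X]/(bval (f - g)) bvalB.
  exact: b_degB.
exact: b_deg_dbr bf bg.
Qed.

Lemma bZ4_double f : bZ n 4 f -> brackets (bZ n 3) (bZ n 1) (f *+ 2).
Proof.
move=> bf; apply: brackets31P.
rewrite !mulr2n -[X in brackets31 X]/(bval (f + f)).
have -> : bval (f + f) = bval f + bval f.
  exact: (raddfD (val : bLie n -> Der n)).
by rewrite -mulr2n; apply: b_deg4_double.
Qed.

Lemma bZ4E : (n < 4)%N -> bZ n 4 = brackets (bZ n 3) (bZ n 1).
Proof.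
move=> n4; apply/seteqP; split=> f; last exact: brackets_bZ4.
by move=> bf; apply: brackets31P; exact: b_deg4_brackets31 n4 bf.
Qed.

Lemma tpure_brackets f q : brackets (bZ n 3) (bZ n 1) f ->
  bracketsQ (bQ n 3) (bQ n 1) (tpure f q : bLieQ n).
Proof.
have pD := pure_biadd (bLie n) rat.
move: f; apply: zspan_ind => [|f g Bf Bg|_ [f bf [g bg <-]]] /=.
- by rewrite (biadd0l pD); apply/qspanpP/rpred0.
- move: Bf Bg => /= /qspanpP Bf /qspanpP Bg.
  by rewrite (biaddBl pD); apply/qspanpP/rpredB.
apply: sub_qspan; exists (tpure f q : bLieQ n).
  by apply: sub_qspan; exists f, q.
exists (tpure g 1 : bLieQ n); first by apply: sub_qspan; exists g, 1.
by rewrite /bbrQ (rbr_pure (bbr_biadd n)) mulr1.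
Qed.

Lemma bbrQZ a b (s t : bLieQ n) :
  bbrQ (a *: s) (b *: t) = (a * b) *: bbrQ s t.
Proof.
have bD := rbr_biadd (bbr_biadd n); rewrite /bbrQ.
elim/tens_ind: s => [|s IH|s s' IH IH'|f p].
- by rewrite scaler0 !(biadd0l bD) scaler0.
- by rewrite scalerN !(biaddNl bD) scalerN IH.
- by rewrite scalerDr !bD.1 scalerDr IH IH'.
elim/tens_ind: t => [|t IH|t t' IH IH'|g q].
- by rewrite scaler0 !(biadd0r bD) scaler0.
- by rewrite scalerN !(biaddNr bD) scalerN IH.
- by rewrite scalerDr !bD.2 scalerDr IH IH'.
rewrite -![_ *: _]/(rscale _ _) !rscale_pure !(rbr_pure (bbr_biadd n)).
by rewrite rscale_pure mulrACA.
Qed.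

Lemma bbrQ_linearl a (s s' t : bLieQ n) :
  bbrQ (a *: s + s') t = a *: bbrQ s t + bbrQ s' t.
Proof.
rewrite [LHS](rbr_biadd (bbr_biadd n)).1; congr (_ + _).
by have := bbrQZ a 1 s t; rewrite scale1r mulr1.
Qed.

Lemma bbrQ_linearr a (s t t' : bLieQ n) :
  bbrQ s (a *: t + t') = a *: bbrQ s t + bbrQ s t'.
Proof.
rewrite [LHS](rbr_biadd (bbr_biadd n)).2; congr (_ + _).
by have := bbrQZ 1 a s t; rewrite scale1r mul1r.
Qed.

Lemma qspan_ind (M : lmodType rat) (S P : set M) :
    P 0 -> (forall a x y, P x -> P y -> P (a *: x + y)) -> S `<=` P ->
  qspan S `<=` P.
Proof.
move=> P0 PD SP x; apply; split=> //; split; first exact/mem_set.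
by move=> a u v /set_mem Pu /set_mem Pv; apply/mem_set/PD.
Qed.

Lemma bbrQ_bQ k l s t : (0 < k)%N -> (0 < l)%N ->
  bQ n k s -> bQ n l t -> bQ n (k + l) (bbrQ s t).
Proof.
move=> k0 l0; have bD := rbr_biadd (bbr_biadd n).
move: s; apply: qspan_ind => [|a s s' IH IH'|_ [f [p [bf ->]]]] Bt.
- by rewrite /bbrQ (biadd0l bD); apply/qspanpP/rpred0.
- rewrite bbrQ_linearl.
  by apply/qspanpP; rewrite rpredD ?rpredZ //; apply/qspanpP;
    [apply: IH|apply: IH'].
move: t Bt; apply: qspan_ind => [|a t t' IH IH'|_ [g [q [bg ->]]]] /=.
- by rewrite /bbrQ (biadd0r bD); apply/qspanpP/rpred0.
- rewrite bbrQ_linearr.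
  by apply/qspanpP; rewrite rpredD ?rpredZ //; exact/qspanpP.
rewrite /bbrQ (rbr_pure (bbr_biadd n)); apply: sub_qspan.
by exists (bbr f g), (p * q); split=> //; apply: b_deg_dbr.
Qed.

Lemma bQ4E : bQ n 4 = bracketsQ (bQ n 3) (bQ n 1).
Proof.
apply/seteqP; split.
  apply: qspan_ind => [|a x y|_ [f [q [bf ->]]]].
  - by apply/qspanpP/rpred0.
  - by move=> /qspanpP Bx /qspanpP By; apply/qspanpP; rewrite rpredD ?rpredZ.
  (* Only 2 f is known to be a bracket over the integers. *)
  have -> : tpure f q = tpure (f *+ 2) (q / 2) :> bLieQ n.
    rewrite (mulr2n f) (pure_biadd _ _).1 -(pure_biadd _ _).2; congr tpure.
    by rewrite -mulr2n -(mulr_natr (q / 2)) divfK.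
  by apply: tpure_brackets; exact: bZ4_double.
apply: qspan_ind => [|a x y|_ [s Bs [t Bt <-]]].
- by apply/qspanpP/rpred0.
- by move=> /qspanpP Bx /qspanpP By; apply/qspanpP; rewrite rpredD ?rpredZ.
exact: (@bbrQ_bQ 3 1).
Qed.

Lemma H1Z_deg4 : bZ n 4 = brackets (bZ n 3) (bZ n 1) ->
  H1Z_deg n 4 = [set 0].
Proof.
move=> E; apply/seteqP; split=> [_ [f bf <-]|_ ->].
  apply/H1Z_pi_eq0; move: f bf; rewrite E.
  apply: zspan_ind => [|f g|_ [x _ [y _ <-]]]; [exact: zspan0|exact: zspanB|].
  by apply: sub_zspan; exists x => //; exists y.
exists 0; first by rewrite E; apply: zspan0.
by apply/H1Z_pi_eq0; exact: zspan0.
Qed.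

Lemma H1Q_deg4 : bQ n 4 = bracketsQ (bQ n 3) (bQ n 1) ->
  H1Q_deg n 4 = [set 0].
Proof.
move=> E; apply/seteqP; split=> [_ [f bf <-]|_ ->].
  apply/H1Q_pi_eq0; move: f bf; rewrite E.
  apply: qspan_ind => [|a f g /qspanpP Bf /qspanpP Bg|_ [x _ [y _ <-]]].
  - by apply/qspanpP/rpred0.
  - by apply/qspanpP; rewrite rpredD ?rpredZ.
  by apply: sub_qspan; exists x => //; exists y.
exists 0; first by rewrite E; apply/qspanpP/rpred0.
by apply/H1Q_pi_eq0; apply/qspanpP/rpred0.
Qed.
End Transfer.

Theorem proposition8p10 :
  ((forall n : nat, (4 <= n)%N ->
      bQ n 4 = bracketsQ (bQ n 3) (bQ n 1)) /\
   bZ 3 4 = brackets (bZ 3 3) (bZ 3 1)) /\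
  ((forall n : nat, (4 <= n)%N -> H1Q_deg n 4 = [set 0]) /\
   H1Z_deg 3 4 = [set 0]).
Proof.
by split; split=> [n n4|]; [exact: bQ4E|exact: bZ4E|exact: H1Q_deg4 (bQ4E n)
  |exact: H1Z_deg4 (bZ4E _)].
Qed.
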